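(* Let $T$ be a complete first-order theory, let $\mathfrak{C}\prec\mathfrak{C}'$, $\bar c$, $EL$, the minimal left ideal $\mathcal{M}\subseteq EL$, the idempotent $u\in\mathcal{M}$, the $\tau$-topology on $u\mathcal{M}$, the subgroup $H(u\mathcal{M})$, and the group epimorphism $f\colon u\mathcal{M}\to \mathrm{Gal}_L(T)$ be as defined in the context. Suppose that $u\mathcal{M}$ is equipped with the $\tau$-topology and $u\mathcal{M}/H(u\mathcal{M})$ with the induced quotient topology. Then: (1) $f$ is continuous. (2) $H(u\mathcal{M})\leq \ker(f)$. (3) The formula $pH(u\mathcal{M})\mapsto f(p)$ yields a well-defined continuous epimorphism $\bar f$ from $u\mathcal{M}/H(u\mathcal{M})$ to $\mathrm{Gal}_L(T)$. In particular, one gets a sequence of continuous epimorphisms $$u\mathcal{M}\twoheadrightarrow u\mathcal{M}/H(u\mathcal{M})\xrightarrow{\ \bar f\ }\mathrm{Gal}_L(T)\twoheadrightarrow \mathrm{Gal}_{KP}(T),$$ where the first and last maps are the quotient maps.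
   Context: ''Compact'' does not include Hausdorff. A monster model is a model that is $\kappa$-saturated and strongly $\kappa$-homogeneous for a sufficiently large strong limit cardinal $\kappa$ (its degree of saturation); ''small'' means of cardinality less than the degree of saturation. $\mathfrak{C}$ is a monster model of $T$, $\bar c$ is a tuple enumerating all elements of $\mathfrak{C}$, and $\mathfrak{C}'\succ\mathfrak{C}$ is a bigger monster model whose degree of saturation is much bigger than $|\mathfrak{C}|$. Put $S_{\bar c}(\mathfrak{C})=\{\mathrm{tp}(\bar a/\mathfrak{C}) : \bar a\equiv\bar c\}$ ($\bar a$ from $\mathfrak{C}'$), a compact Hausdorff space on which $\mathrm{Aut}(\mathfrak{C})$ acts naturally. $EL$ is the Ellis semigroup of this action: the closure of $\mathrm{Aut}(\mathfrak{C})$ (each automorphism viewed as a map $S_{\bar c}(\mathfrak{C})\to S_{\bar c}(\mathfrak{C})$) in the product space $S_{\bar c}(\mathfrak{C})^{S_{\bar c}(\mathfrak{C})}$, with composition as semigroup operation; $\mathrm{Aut}(\mathfrak{C})$ is regarded as a subset of $EL$. $\mathcal{M}$ is any minimal left ideal of $EL$ and $u\in\mathcal{M}$ any idempotent; then $u\mathcal{M}$ is a group with identity $u$ (the Ellis group). For $A\subseteq EL$ and $p\in EL$, $p\circ A$ is the set of all $\eta\in EL$ for which there are nets $(\eta_i)$ in $A$ and $(g_i)$ in $\mathrm{Aut}(\mathfrak{C})$ with $\lim g_i=p$ and $\lim g_i\eta_i=\eta$. For $A\subseteq u\mathcal{M}$, $\mathrm{cl}_\tau(A)=(u\circ A)\cap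 u\mathcal{M}$; this is a closure operator which defines the $\tau$-topology on $u\mathcal{M}$ (it is compact, $T_1$, and multiplication is separately continuous). $H(u\mathcal{M})$ is the intersection of the sets $\mathrm{cl}_\tau(V)$ over all $\tau$-neighborhoods $V$ of $u$; it is a $\tau$-closed normal subgroup of $u\mathcal{M}$, and $u\mathcal{M}/H(u\mathcal{M})$ with the quotient topology is a compact Hausdorff group. Galois groups (computed in $\mathfrak{C}'$): $\mathrm{Autf}_L(\mathfrak{C}')$ is the (normal) subgroup of $\mathrm{Aut}(\mathfrak{C}')$ generated by all automorphisms fixing pointwise some small submodel; $\mathrm{Gal}_L(T)=\mathrm{Aut}(\mathfrak{C}')/\mathrm{Autf}_L(\mathfrak{C}')$. Its topology: for a small model $M$ enumerated by $\bar m$, $\mathrm{Gal}_L(T)$ carries the quotient topology from the map $S_{\bar m}(M)\to\mathrm{Gal}_L(T)$, $\mathrm{tp}(\sigma(\bar m)/M)\mapsto\sigma\,\mathrm{Autf}_L(\mathfrak{C}')$ (well defined and independent of $M$); it is a compact, not necessarily Hausdorff, topological group. $\mathrm{Gal}_0(T)$ is the closure of the identity in $\mathrm{Gal}_L(T)$, and $\mathrm{Gal}_{KP}(T)=\mathrm{Gal}_L(T)/\mathrm{Gal}_0(T)$ with the quotient topology. For $x\in EL$ let $\pi_0(x)=x(\mathrm{tp}(\bar c/\mathfrak{C}))\in S_{\bar c}(\mathfrak{C})$. The map $\hat f\colon EL\to\mathrm{Gal}_L(T)$ is $\hat f(x)=\sigma'\,\mathrm{Autf}_L(\mathfrak{C}')$,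 where $\sigma'\in\mathrm{Aut}(\mathfrak{C}')$ is any automorphism with $\sigma'(\bar c)\models\pi_0(x)$ (this is well defined and a semigroup epimorphism). $f$ is the restriction of $\hat f$ to $u\mathcal{M}$; it is a group epimorphism onto $\mathrm{Gal}_L(T)$. *)

(* Defs.v *)
From HB Require Import structures.
From mathcomp Require Import all_boot.
From mathcomp Require Import boolp classical_sets functions cardinality filter.
From mathcomp Require Import topology.

Set Implicit Arguments.
Unset Strict Implicit.
Unset Printing Implicit Defensive.

Local Open Scope classical_set_scope.
Local Open Scope group_scope.
Local Open Scope quotient_scope.

Record language := Language {
  fun_sym : Type;
  fun_arity : fun_sym -> nat;
  rel_sym : Type;
  rel_arity : rel_sym -> nat
}.

Inductive term (L : language) (V : Type) : Type :=
| Var of V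
| App (f : fun_sym L) of ('I_(fun_arity f) -> term L V).
Arguments Var {L V}.

(* [formula L V]: formulas whose free variables are among the elements of V;
   a quantifier binds the variable [None] of [option V]. *)
Inductive formula (L : language) (V : Type) : Type :=
| Bot
| Eqn of term L V & term L V
| Rel (r : rel_sym L) of ('I_(rel_arity r) -> term L V)
| Imp of formula L V & formula L V
| All of formula L (option V).
Arguments Bot {L V}.

Definition Neg L V (phi : formula L V) := Imp phi Bot.
Definition And L V (phi psi : formula L V) := Neg (Imp phi (Neg psi)).

Fixpoint tsubst_var L V W (h : V -> W) (t : term L V) : term L W :=
  match t with
  | Var x => Var (h x)
  | App f ts => App (fun i => tsubst_var h (ts i))
  end.

Fixpoint subst_var L V W (h : V -> W) (phi : formula L V) : formula L W :=
  match phi with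
  | Bot => Bot
  | Eqn s t => Eqn (tsubst_var h s) (tsubst_var h t)
  | Rel r ts => Rel (fun i => tsubst_var h (ts i))
  | Imp a b => Imp (subst_var h a) (subst_var h b)
  | All a => All (subst_var (omap h) a)
  end.

Record structure (L : language) := Structure {
  carrier :> Type;
  fun_interp : forall f : fun_sym L, ('I_(fun_arity f) -> carrier) -> carrier;
  rel_interp : forall r : rel_sym L, ('I_(rel_arity r) -> carrier) -> Prop;
  carrier_nonempty : inhabited carrier
}.
Arguments fun_interp {L} s f.
Arguments rel_interp {L} s r.

Fixpoint eval L (M : structure L) V (v : V -> M) (t : term L V) : M :=
  match t with
  | Var x => v x
  | App f ts => fun_interp M f (fun i => eval v (ts i))
  end.

Fixpoint sat L (M : structure L) V (v : V -> M) (phi : formula L V) : Prop :=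
  match phi with
  | Bot => False
  | Eqn s t => eval v s = eval v t
  | Rel r ts => rel_interp M r (fun i => eval v (ts i))
  | Imp a b => sat v a -> sat v b
  | All a => forall x : M, sat (oapp v x) a
  end.

Definition sentence L := formula L void.
Definition theory L := set (sentence L).

Definition holds L (M : structure L) (phi : sentence L) : Prop :=
  sat (of_void M) phi.
Definition models L (M : structure L) (T : theory L) : Prop :=
  forall phi, T phi -> holds M phi.
Definition entails L (T : theory L) (phi : sentence L) : Prop :=
  forall M : structure L, models M T -> holds M phi.

Definition complete L (T : theory L) : Prop :=
  (exists M : structure L, models M T) /\
  (forall phi, entails T phi \/ entails T (Neg phi)).

Definition elementary L (M N : structure L) (j : M -> N) : Prop :=
  forall V (v : V -> M) (phi : formula L V), sat (j \o v) phi <-> sat v phi.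

(* A tuple is a family indexed by an arbitrary type. *)
Definition tuple_cat I J (A : Type) (a : I -> A) (b : J -> A) : I + J -> A :=
  fun k => match k with inl i => a i | inr j => b j end.

Definition tp L (N : structure L) I (a : I -> N) : set (formula L I) :=
  [set phi | sat a phi].

(* The type of [a] over the set of parameters enumerated by [b]: the variable
   [inl i] stands for x_i, and [inr j] for the parameter [b j]. *)
Definition tp_over L (N : structure L) I J (a : I -> N) (b : J -> N) :
  set (formula L (I + J)) := tp (tuple_cat a b).

(* A cardinal is represented by a type of that cardinality. *)

Definition smaller (X Y : Type) : Prop :=
  ([set: X] #<= [set: Y])%card /\ ~ ([set: Y] #<= [set: X])%card.

Definition strong_limit (kappa : Type) : Prop :=
  forall X : Type, smaller X kappa -> smaller (set X) kappa.

Definition finitely_satisfiable L (M : structure L) I (A : set M)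
    (p : set (formula L (I + A))) : Prop :=
  forall n (s : 'I_n -> formula L (I + A)), (forall i, p (s i)) ->
  exists x : I -> M, forall i, tp_over x (@set_val _ A) (s i).

Definition saturated L (kappa : Type) (M : structure L) : Prop :=
  forall A : set M, smaller A kappa ->
  forall p : set (formula L (unit + A)), finitely_satisfiable p ->
  exists x : unit -> M, p `<=` tp_over x (@set_val _ A).

Record aut L (M : structure L) := Aut {
  aut_fun :> M -> M;
  aut_inv : M -> M;
  aut_funK : cancel aut_fun aut_inv;
  aut_invK : cancel aut_inv aut_fun;
  aut_fun_interp : forall f a,
    aut_fun (fun_interp M f a) = fun_interp M f (aut_fun \o a);
  aut_rel_interp : forall r a,
    rel_interp M r (aut_fun \o a) <-> rel_interp M r a
}.

Definition strongly_homogeneous L (kappa : Type) (M : structure L) : Prop :=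
  forall (I : Type) (a b : I -> M), smaller I kappa -> tp a = tp b ->
  exists s : aut M, s \o a = b.

(* "Sufficiently large" is read as: larger than |L| + aleph_0. *)
Record monster L (T : theory L) := Monster {
  monster_str :> structure L;
  degree : Type;
  monster_models : models monster_str T;
  degree_strong_limit : strong_limit degree;
  degree_large : smaller (fun_sym L + rel_sym L + nat) degree;
  monster_saturated : saturated degree monster_str;
  monster_homogeneous : strongly_homogeneous degree monster_str
}.
Arguments degree {L T} m.

(* As the degree of C' is a strong limit cardinal greater than |C|, it is also
   greater than 2^|C|, 2^(2^|C|), etc. *)
Record bigger_monster L (T : theory L) (C : monster T) := BiggerMonster {
  bigger_str :> monster T;
  incl : C -> bigger_str;
  incl_elementary : elementary incl;
  degree_bigger : smaller C (degree bigger_str)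
}.
Arguments incl {L T C} b.

Record small_model L (T : theory L) (N : monster T) := SmallModel {
  small_str :> structure L;
  small_incl : small_str -> N;
  small_elementary : elementary small_incl;
  small_small : smaller small_str (degree N)
}.
Arguments small_incl {L T N} s.

Lemma smaller_le (X Y Z : Type) (h : X -> Y) :
  injective h -> smaller Y Z -> smaller X Z.
Proof.
move=> hinj [YZ ZY].
have XY : ([set: X] #<= [set: Y])%card.
  have /card_eqPle [] : (h @` [set: X] #= [set: X])%card.
    by apply: inj_card_eq => x y _ _; exact: hinj.
  by move=> _ /card_le_trans; apply; exact: card_leT.
split; first exact: card_le_trans YZ.
by move=> ZX; apply: ZY; exact: card_le_trans ZX XY.
Qed.

Lemma smaller_sum (X Z : Type) : strong_limit Z -> smaller X Z ->
  smaller (X + X) Z.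
Proof.
move=> sl XZ.
pose h (k : X + X) : set (set X) := match k with
  | inl x => [set [set x]] | inr x => [set [set x]; set0] end.
apply: (@smaller_le _ (set (set X)) _ h); last exact/sl/sl.
have n0 (x : X) : [set x] <> set0.
  by move=> /seteqP [/(_ x erefl)].
have set1_inj (x y : X) : [set x] = [set y] -> x = y.
  by move=> /seteqP [/(_ x erefl)].
move=> [x|x] [y|y] /= /seteqP [xy yx].
- by congr inl; apply: set1_inj; exact: (xy _ erefl).
- by have := yx set0 (or_intror erefl) => /= /esym /n0.
- by have := xy set0 (or_intror erefl) => /= /esym /n0.
- by congr inr; apply: set1_inj; case: (xy [set x] (or_introl erefl)) => // /n0.
Qed.

Lemma eval_subst_var L (M : structure L) V W (h : V -> W) (v : W -> M) t :
  eval v (tsubst_var h t) = eval (v \o h) t.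
Proof. by elim: t => //= f ts IH; congr fun_interp; apply/funext => i. Qed.

Lemma sat_subst_var L (M : structure L) V W (h : V -> W) (v : W -> M) phi :
  sat v (subst_var h phi) <-> sat (v \o h) phi.
Proof.
elim: phi W h v => //= {V}.
- by move=> V s t W h v; rewrite !eval_subst_var.
- move=> V r ts W h v.
  have -> // : (fun i => eval v (tsubst_var h (ts i))) =
               (fun i => eval (v \o h) (ts i)).
  by apply/funext => i; exact: eval_subst_var.
- by move=> V a IHa b IHb W h v; rewrite IHa IHb.
- move=> V a IH W h v; split=> H x; have := H x; rewrite IH;
  by congr (sat _ _); apply/funext => -[].
Qed.

Lemma eval_aut L (M : structure L) (s : aut M) V (v : V -> M) t :
  eval (s \o v) t = s (eval v t).
Proof.
elim: t => //= f ts IH; rewrite aut_fun_interp; congr fun_interp.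
by apply/funext => i /=.
Qed.

Lemma sat_aut L (M : structure L) (s : aut M) V (v : V -> M) phi :
  sat (s \o v) phi <-> sat v phi.
Proof.
elim: phi v => //= {V}.
- move=> V a b v; rewrite !eval_aut; split => [|->//].
  exact: (can_inj (@aut_funK _ _ s)).
- move=> V r ts v; rewrite -[X in _ <-> X](aut_rel_interp s).
  have -> // : (fun i => eval (s \o v) (ts i)) = s \o (fun i => eval v (ts i)).
  by apply/funext => i; exact: eval_aut.
- by move=> V a IHa b IHb v; rewrite IHa IHb.
- move=> V a IH v; split=> H x.
    have := H (s x); rewrite (_ : oapp _ _ = s \o oapp v x) ?IH //.
    by apply/funext => -[].
  have /IH := H (aut_inv s x); congr (sat _ _).
  by apply/funext => -[] //=; rewrite aut_invK.
Qed.

Lemma tp_aut L (M : structure L) (s : aut M) I (a : I -> M) :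
  tp (s \o a) = tp a.
Proof. by apply/seteqP; split => phi /=; rewrite /tp /= sat_aut. Qed.

Lemma tp_subst_var L (M : structure L) I J (a : I -> M) (h : J -> I) :
  tp (a \o h) = [set phi | tp a (subst_var h phi)].
Proof. by apply/seteqP; split => phi /=; rewrite /tp /= sat_subst_var. Qed.

Lemma aut_ext L (M : structure L) (s t : aut M) : s =1 t -> s = t.
Proof.
case: s => f f' fK f'K ff fr; case: t => g g' gK g'K gf gr /= /funext fg.
subst g.
have fg' : f' = g' by apply/funext => x; rewrite -{1}(g'K x) fK.
subst g'; congr Aut; exact: Prop_irrelevance.
Qed.

Section AutGroup.
Context (L : language) (M : structure L).

HB.instance Definition _ := gen_eqMixin (aut M).
HB.instance Definition _ := gen_choiceMixin (aut M).

Program Definition aut_one : aut M := @Aut L M id id _ _ _ _.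
Solve All Obligations with by [].

Program Definition aut_mul (s t : aut M) : aut M :=
  @Aut L M (s \o t) (aut_inv t \o aut_inv s) _ _ _ _.
Next Obligation. by move=> s t x /=; rewrite !aut_funK. Qed.
Next Obligation. by move=> s t x /=; rewrite !aut_invK. Qed.
Next Obligation. by move=> s t f a /=; rewrite !aut_fun_interp. Qed.
Next Obligation. by move=> s t r a; rewrite -compA !aut_rel_interp. Qed.

Program Definition aut_V (s : aut M) : aut M := @Aut L M (aut_inv s) s _ _ _ _.
Next Obligation. exact: aut_invK. Qed.
Next Obligation. exact: aut_funK. Qed.
Next Obligation.
move=> s f a; apply: (can_inj (@aut_funK _ _ s)).
rewrite aut_invK aut_fun_interp; congr fun_interp.
by apply/funext => i /=; rewrite aut_invK.
Qed.
Next Obligation.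
move=> s r a; rewrite -(aut_rel_interp s).
by rewrite (_ : s \o _ = a) //; apply/funext => i /=; rewrite aut_invK.
Qed.

Fact aut_mulA : associative aut_mul. Proof. by move=> *; exact: aut_ext. Qed.
Fact aut_mul1 : left_id aut_one aut_mul. Proof. by move=> *; exact: aut_ext. Qed.
Fact aut_1mul : right_id aut_one aut_mul. Proof. by move=> *; exact: aut_ext. Qed.
Fact aut_mulV : left_inverse aut_one aut_V aut_mul.
Proof. by move=> s; apply: aut_ext => x /=; rewrite aut_funK. Qed.
Fact aut_Vmul : right_inverse aut_one aut_V aut_mul.
Proof. by move=> s; apply: aut_ext => x /=; rewrite aut_invK. Qed.

HB.instance Definition _ :=
  isGroup.Build (aut M) aut_mulA aut_mul1 aut_1mul aut_mulV aut_Vmul.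
End AutGroup.

Section FinalTopology.
Context (X : topologicalType) (Y : Type) (h : X -> Y).

Definition final_open : set_system Y := [set U | open (h @^-1` U)].

Lemma final_openT : final_open setT.
Proof. by rewrite /final_open /= preimage_setT; exact: openT. Qed.

Lemma final_openI : setI_closed final_open.
Proof.
by move=> U V oU oV; rewrite /final_open /= preimage_setI; exact: openI oU oV.
Qed.

Lemma final_open_bigU (I : Type) (U : I -> set Y) :
  (forall i, final_open (U i)) -> final_open (\bigcup_i U i).
Proof.
move=> oU; rewrite /final_open /= preimage_bigcup.
by apply: bigcup_open => i _; exact: oU.
Qed.
End FinalTopology.

HB.structure Definition TopBaseUMagma := {G of BaseUMagma G & Topological G}.

(* G / N is the space of left cosets xN, multiplied through representatives
   (the group structure when N is a normal subgroup). *)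
Section Quotient.
Context (G : ChoiceBaseUMagma.type) (N : set G).

Definition lcoset (x : G) : set G := [set x * n | n in N].
Definition same_lcoset (x y : G) : bool := `[< lcoset x = lcoset y >].

Lemma same_lcoset_equiv : equiv_class_of same_lcoset.
Proof.
split=> [x|x y|y x z]; first exact/asboolP.
  by rewrite /same_lcoset; apply: asbool_equiv_eq; split.
by move=> /asboolP xy; rewrite /same_lcoset xy.
Qed.
Canonical same_lcoset_rel := EquivRelPack same_lcoset_equiv.

Definition quot : Type := {eq_quot same_lcoset_rel}.
HB.instance Definition _ := EqQuotient.on quot.
HB.instance Definition _ := Choice.on quot.

Definition coset (x : G) : quot := \pi_quot x.

Definition quot_mul (X Y : quot) : quot := coset (repr X * repr Y).
HB.instance Definition _ := hasMul.Build quot quot_mul.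
HB.instance Definition _ := hasOne.Build quot (coset 1).
End Quotient.

HB.instance Definition _ (G : TopBaseUMagma.type) (N : set G) :=
  isOpenTopological.Build (quot N) (final_openT (coset N))
    (final_openI (h := coset N)) (final_open_bigU (h := coset N)).

Definition subgroup (G : groupType) (H : set G) : Prop :=
  [/\ H 1, forall x y, H x -> H y -> H (x * y) & forall x, H x -> H x^-1].

(* S_m(M) = {tp(a/M) : a \equiv m}, where M is embedded in N by the
   enumeration m : M -> N of its image, and a ranges over tuples from N. *)
Definition type_space L (M N : structure L) (m : M -> N) : Type :=
  {p : set (formula L (M + M)) |
    exists a : M -> N, tp a = tp m /\ p = tp_over a m}.

Section TypeSpace.
Context (L : language) (M N : structure L) (m : M -> N).
Local Notation S := (type_space m).

HB.instance Definition _ := gen_eqMixin S.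
HB.instance Definition _ := gen_choiceMixin S.

Lemma type_space_ext (p q : S) : sval p = sval q -> p = q.
Proof. by case: p q => p Hp [q Hq] /= pq; subst q; congr exist; exact: Prop_irrelevance. Qed.

Lemma type_space_And (p : S) phi psi :
  sval p (And phi psi) <-> sval p phi /\ sval p psi.
Proof.
case: p => p [a [_ pE]] /=; rewrite pE /tp_over /tp /=; split; last by tauto.
by move=> H; split; apply: contrapT; tauto.
Qed.

Definition type_open : set_system S := [set U |
  forall p, U p -> exists phi, sval p phi /\ [set q : S | sval q phi] `<=` U].

Fact type_openT : type_open setT.
Proof.
move=> p _; exists (Imp Bot Bot); split=> //.
by case: p => p [a [_ pE]] /=; rewrite pE.
Qed.

Fact type_openI : setI_closed type_open.
Proof.
move=> U V oU oV p [/oU [phi [pphi sU]] /oV [psi [ppsi sV]]].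
exists (And phi psi); split; first exact/type_space_And.
by move=> q /type_space_And [/sU ? /sV].
Qed.

Fact type_open_bigU (I : Type) (U : I -> set S) :
  (forall i, type_open (U i)) -> type_open (\bigcup_i U i).
Proof.
move=> oU p [i _ /oU [phi [pphi sU]]]; exists phi; split=> // q /sU.
by exists i.
Qed.

HB.instance Definition _ :=
  isOpenTopological.Build S type_openT type_openI type_open_bigU.

Lemma type_openE : @open S = type_open. Proof. by []. Qed.
End TypeSpace.

Section GalL.
Context (L : language) (T : theory L) (N : monster T).

Definition fixes_small_model (s : aut N) : Prop :=
  exists M : small_model N, s \o small_incl M = small_incl M.

Definition AutfL : set (aut N) := smallest (@subgroup (aut N)) fixes_small_model.

Lemma AutfL_subgroup : subgroup AutfL.
Proof.
split=> [H [[]] //|x y Hx Hy H sH|x Hx H sH].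
  by case: (sH) => -[_ HM _] _; apply: HM; [exact: Hx|exact: Hy].
by case: (sH) => -[_ _ HV] _; apply: HV; exact: Hx.
Qed.

Lemma AutfL_fix s : fixes_small_model s -> AutfL s.
Proof. by move=> Hs H [_]; apply. Qed.

Lemma fixes_small_model_conj (s t : aut N) :
  fixes_small_model s -> fixes_small_model (t * s * t^-1).
Proof.
case=> M sM.
have el : elementary (t \o small_incl M).
  by move=> V v phi; rewrite -compA sat_aut; exact: small_elementary.
exists (SmallModel el (small_small M)).
apply/funext => x /=; rewrite aut_funK.
by have /(congr1 (fun h => h x)) /= -> := sM.
Qed.

Lemma AutfL_normal (s t : aut N) : AutfL s -> AutfL (t * s * t^-1).
Proof.
move=> Hs; have [A1 AM AV] := AutfL_subgroup.
apply: (Hs [set s | AutfL (t * s * t^-1)]); split; last first.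
  by move=> r fr /=; apply: AutfL_fix; apply: fixes_small_model_conj.
split=> [|x y Hx Hy|x Hx] /=; first by rewrite mulg1 mulgV.
  by have := AM _ _ Hx Hy; rewrite !mulgA mulgVK.
by have := AV _ Hx; rewrite !invgM invgK mulgA.
Qed.

(* The parameter M only serves to define the topology. *)
Definition GalL (M : small_model N) : Type := quot AutfL.

Section Topology.
Context (M : small_model N).
Local Notation m := (small_incl M).

HB.instance Definition _ := BaseUMagma.on (GalL M).
HB.instance Definition _ := Choice.on (GalL M).

(* sigma Autf_L, for any sigma with tp(sigma(m)/M) = p: see GalL_of_typeE for
   the independence of the choice, and type_space_aut for existence. *)
Definition GalL_of_type (p : type_space m) : GalL M :=
  coset AutfL (xget 1 [set s : aut N | tp_over (s \o m) m = sval p]).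

HB.instance Definition _ := isOpenTopological.Build (GalL M)
  (final_openT GalL_of_type) (final_openI (h := GalL_of_type))
  (final_open_bigU (h := GalL_of_type)).
End Topology.

Lemma type_space_aut (M : small_model N) (p : type_space (small_incl M)) :
  exists s : aut N, tp_over (s \o small_incl M) (small_incl M) = sval p.
Proof.
case: p => p [a [am pE]] /=; rewrite pE.
have [s <-] := monster_homogeneous (small_small M) (esym am).
by exists s.
Qed.

Lemma AutfL_coset (s t : aut N) : AutfL (s^-1 * t) -> coset AutfL s = coset AutfL t.
Proof.
have [A1 AM AV] := AutfL_subgroup.
move=> st; apply/eqquotP/asboolP/seteqP; split=> _ [n An <-].
  exists (t^-1 * s * n); last by rewrite !mulgA mulgV mul1g.
  by apply: (AM _ _ _ An); have := AV _ st; rewrite invgM invgK.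
exists (s^-1 * t * n); last by rewrite !mulgA mulgV mul1g.
exact: AM.
Qed.

Lemma tp_over_coset (M : small_model N) (s t : aut N) :
  tp_over (s \o small_incl M) (small_incl M) =
    tp_over (t \o small_incl M) (small_incl M) ->
  coset AutfL s = coset AutfL t.
Proof.
set m := small_incl M => st; apply: AutfL_coset.
have [r rE] := monster_homogeneous
  (smaller_sum (@degree_strong_limit _ _ N) (small_small M)) st.
have rs : r \o (s \o m) = t \o m.
  by apply/funext => x; have /(congr1 (fun h => h (inl x))) := rE.
have rm : r \o m = m.
  by apply/funext => x; have /(congr1 (fun h => h (inr x))) := rE.
have [_ AM _] := AutfL_subgroup.
have -> : s^-1 * t = (s^-1 * r * s^-1^-1) * (s^-1 * r^-1 * t).
  by rewrite invgK !mulgA !mulgK.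
apply: AM; first by apply: AutfL_normal; apply: AutfL_fix; exists M.
apply: AutfL_fix; exists M; apply/funext => x /=.
have /(congr1 (fun h => h x)) /= <- := rs.
by rewrite !aut_funK.
Qed.

Lemma GalL_of_typeE (M : small_model N) (p : type_space (small_incl M))
    (s : aut N) :
  tp_over (s \o small_incl M) (small_incl M) = sval p ->
  GalL_of_type p = coset AutfL s.
Proof.
move=> sp; apply: tp_over_coset (M) _ _ _; rewrite sp.
by case: xgetP => [t _ //|/(_ s)].
Qed.

End GalL.
Arguments AutfL {L T} N.

Section EllisGroup.
Context (E : semigroupType).

Definition left_ideal (I : set E) : Prop :=
  I !=set0 /\ forall x y, I y -> I (x * y).

Definition minimal_left_ideal (I : set E) : Prop :=
  left_ideal I /\ forall J, left_ideal J -> J `<=` I -> J = I.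

Record ellis_datum := EllisDatum {
  ideal : set E;
  idem : E;
  ideal_minimal : minimal_left_ideal ideal;
  idem_ideal : ideal idem;
  idem_idem : idem * idem = idem
}.

Variable D : ellis_datum.
Local Notation M := (ideal D).
Local Notation u := (idem D).

Definition ellis_group : Type := {x : E | exists2 y, M y & x = u * y}.

HB.instance Definition _ := gen_eqMixin ellis_group.
HB.instance Definition _ := gen_choiceMixin ellis_group.

Lemma ellis_ext (p q : ellis_group) : sval p = sval q -> p = q.
Proof.
case: p q => p Hp [q Hq] /= pq; subst q; congr exist; exact: Prop_irrelevance.
Qed.

Lemma ideal_mull x y : M y -> M (x * y).
Proof. by case: (ideal_minimal D) => -[_ H] _; exact: H. Qed.

Lemma ellis_ideal (p : ellis_group) : M (sval p).
Proof. by have [y My ->] := svalP p; exact: ideal_mull. Qed.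

Lemma ellis_idl (p : ellis_group) : u * sval p = sval p.
Proof. by have [y My ->] := svalP p; rewrite mulgA idem_idem. Qed.

Lemma ideal_idr x : M x -> x * u = x.
Proof.
have [Mid Mmin] := ideal_minimal D.
suff <- : [set y * u | y in setT] = M.
  by move=> -[y _ <-]; rewrite -mulgA idem_idem.
apply: Mmin => [|_ [y _ <-]]; last exact/ideal_mull/idem_ideal.
split; first by exists (u * u), u.
by move=> x' _ [y _ <-]; exists (x' * y) => //; rewrite mulgA.
Qed.

Lemma ellis_mul_subproof (p q : ellis_group) :
  exists2 y, M y & sval p * sval q = u * y.
Proof.
exists (sval p * sval q); first exact/ideal_mull/ellis_ideal.
by rewrite mulgA ellis_idl.
Qed.
Definition ellis_mul p q : ellis_group := exist _ _ (ellis_mul_subproof p q).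

Lemma ellis_one_subproof : exists2 y, M y & u = u * y.
Proof. by exists u; [exact: idem_ideal|rewrite idem_idem]. Qed.
Definition ellis_one : ellis_group := exist _ _ ellis_one_subproof.

Lemma ellis_left_inverse (p : ellis_group) :
  exists q, ellis_mul q p = ellis_one.
Proof.
have [Mid Mmin] := ideal_minimal D.
have JM : [set y * sval p | y in M] = M.
  apply: Mmin => [|_ [y My <-]]; last exact/ideal_mull/ellis_ideal.
  split; first by exists (u * sval p), u => //; exact: idem_ideal.
  by move=> x _ [y My <-]; exists (x * y); [exact: ideal_mull|rewrite mulgA].
have [y My yp] : [set y * sval p | y in M] u by rewrite JM; exact: idem_ideal.
have Huy : exists2 z, M z & u * y = u * z by exists y.
exists (exist _ (u * y) Huy); apply: ellis_ext => /=.
by rewrite -mulgA yp idem_idem.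
Qed.

Definition ellis_inv (p : ellis_group) : ellis_group :=
  sval (cid (ellis_left_inverse p)).

Fact ellis_mulA : associative ellis_mul.
Proof. by move=> p q r; apply: ellis_ext; rewrite /= mulgA. Qed.
Fact ellis_mul1g : left_id ellis_one ellis_mul.
Proof. by move=> p; apply: ellis_ext; exact: ellis_idl. Qed.
Fact ellis_mulg1 : right_id ellis_one ellis_mul.
Proof. by move=> p; apply: ellis_ext; exact/ideal_idr/ellis_ideal. Qed.
Fact ellis_mulVg : left_inverse ellis_one ellis_inv ellis_mul.
Proof. by move=> p; rewrite /ellis_inv; case: cid. Qed.
Fact ellis_mulgV : right_inverse ellis_one ellis_inv ellis_mul.
Proof.
move=> p; have := ellis_mulVg p; move: (ellis_inv p) => q qp.
rewrite -[LHS]ellis_mul1g -(ellis_mulVg q) -ellis_mulA; congr ellis_mul.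
by rewrite ellis_mulA qp ellis_mul1g.
Qed.

HB.instance Definition _ := isGroup.Build ellis_group
  ellis_mulA ellis_mul1g ellis_mulg1 ellis_mulVg ellis_mulgV.
End EllisGroup.

Section Dynamics.
Context (L : language) (T : theory L) (C : monster T) (C' : bigger_monster C).

(* The tuple c enumerating C is indexed by C itself. *)
Local Notation c := (incl C').
Definition Sc : Type := type_space c.
HB.instance Definition _ := Topological.on Sc.

Lemma aut_extends (g : aut C) : exists s : aut C', s \o c = c \o g.
Proof.
apply: (monster_homogeneous (degree_bigger C')).
have tpc (h : C -> C) : tp (c \o h) = tp h.
  apply/seteqP; split => phi.
    exact: (proj1 (@incl_elementary _ _ _ C' _ h phi)).
  exact: (proj2 (@incl_elementary _ _ _ C' _ h phi)).
rewrite -[c]/(c \o id) [LHS]tpc -[RHS]/(tp (c \o (g \o id))) [RHS]tpc.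
by rewrite tp_aut.
Qed.

(* phi(x, d) belongs to g.p iff phi(x, g^-1 d) belongs to p *)
Definition act_set (g : aut C) (p : set (formula L (C + C))) :
    set (formula L (C + C)) :=
  [set phi | p (subst_var (fun k => match k with
                                    | inl i => inl i
                                    | inr d => inr (g^-1 d)
                                    end) phi)].

Lemma act_set_tp (g : aut C) (s : aut C') (a : C -> C') : s \o c = c \o g ->
  act_set g (tp_over a c) = tp_over (s \o a) c.
Proof.
move=> sg; rewrite /act_set /tp_over -tp_subst_var.
rewrite -[LHS](tp_aut s); congr tp; apply/funext => -[i|d] //=.
have /(congr1 (fun h => h (g^-1 d))) /= -> := sg.
by congr c; exact: aut_invK.
Qed.

Lemma act_subproof (g : aut C) (p : Sc) :
  exists a : C -> C', tp a = tp c /\ act_set g (sval p) = tp_over a c.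
Proof.
case: p => p [a [ac pE]] /=; have [s sg] := aut_extends g.
by exists (s \o a); rewrite tp_aut pE (act_set_tp _ sg).
Qed.

Definition act (g : aut C) (p : Sc) : Sc := exist _ _ (act_subproof g p).

Definition EL : Type :=
  {x : {ptws Sc -> Sc} | closure (range act : set {ptws Sc -> Sc}) x}.
HB.instance Definition _ := gen_eqMixin EL.
HB.instance Definition _ := gen_choiceMixin EL.
HB.instance Definition _ := Topological.copy EL
  (initial_topology (@proj1_sig _ _ : EL -> {ptws Sc -> Sc})).


Lemma cvg_ptws (F : set_system {ptws Sc -> Sc}) (x : {ptws Sc -> Sc}) :
  Filter F -> F --> x <-> forall p, (fun y : {ptws Sc -> Sc} => y p) @ F --> x p.
Proof.
move=> FF; split=> [Fx p|Fx].
  apply: cvg_trans (@proj_continuous _ (fun=> Sc) p x).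
  exact: cvg_app Fx.
apply/cvg_sup => p U [_ [[W oW <-] Wx WU]].
apply: (filterS WU); apply: (Fx p W).
exact: open_nbhs_nbhs.
Qed.

Lemma ptws_continuous (X : topologicalType) (h : X -> {ptws Sc -> Sc}) :
  (forall p, continuous (fun x => h x p)) -> continuous h.
Proof. by move=> hc x; apply/cvg_ptws => p; exact: hc. Qed.

Lemma act_continuous g : continuous (act g).
Proof.
apply/continuousP => U; rewrite !type_openE => oU p /oU [phi [pphi sU]].
by eexists; split; first exact: pphi; move=> q qphi; exact: sU.
Qed.

Lemma actM g h : act (g * h) = act g \o act h.
Proof.
apply/funext => p; apply: type_space_ext; case: p => p [a [_ pE]] /=.
have [s sg] := aut_extends g; have [t th] := aut_extends h.
have sth : (s * t) \o c = c \o (g * h).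
  rewrite -[RHS]/((c \o g) \o h) -sg -[RHS]/(s \o (c \o h)) -th //.
by rewrite pE (act_set_tp _ sth) (act_set_tp _ th) (act_set_tp _ sg).
Qed.

Lemma closure_image (X Y : topologicalType) (h : X -> Y) (A : set X) (B : set Y)
    (x : X) :
  continuous h -> (forall y, A y -> closure B (h y)) ->
  closure A x -> closure B (h x).
Proof.
move=> hc AB Ax; rewrite (closure_id (closure B)).1; last exact: closed_closure.
move=> U /hc /Ax [y [Ay Uy]]; exists (h y); split=> //; exact: AB.
Qed.

Lemma EL_mul_subproof (x y : EL) :
  closure (range act : set {ptws Sc -> Sc}) (sval x \o sval y).
Proof.
case: x y => x Hx [y Hy] /=.
pose Ry (z : {ptws Sc -> Sc}) : {ptws Sc -> Sc} := z \o y.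
apply: (@closure_image _ _ Ry _ _ _ _ _ Hx).
  apply: ptws_continuous => p; exact: (@proj_continuous _ (fun=> Sc) (y p)).
move=> _ [g _ <-]; pose Lg (z : {ptws Sc -> Sc}) : {ptws Sc -> Sc} := act g \o z.
apply: (@closure_image _ _ Lg _ _ _ _ _ Hy).
  apply: ptws_continuous => p z.
  apply: (@continuous_comp _ _ _ (fun w : {ptws Sc -> Sc} => w p) (act g)).
    exact: (@proj_continuous _ (fun=> Sc) p).
  exact: act_continuous.
move=> _ [h _ <-]; apply: subset_closure; exists (g * h) => //.
exact: actM.
Qed.
Definition EL_mul (x y : EL) : EL := exist _ _ (@EL_mul_subproof x y).

Lemma EL_ext (x y : EL) : sval x = sval y -> x = y.
Proof.
case: x y => x Hx [y Hy] /= xy; subst y; congr exist; exact: Prop_irrelevance.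
Qed.

Fact EL_mulA : associative EL_mul.
Proof. by move=> x y z; exact: EL_ext. Qed.
HB.instance Definition _ := isSemigroup.Build EL EL_mulA.

Lemma EL_act_subproof g : closure (range act : set {ptws Sc -> Sc}) (act g).
Proof. by apply: subset_closure; exists g. Qed.
Definition EL_act (g : aut C) : EL := exist _ _ (@EL_act_subproof g).


Record directed (I : Type) (le : I -> I -> Prop) : Prop := Directed {
  directed_nonempty : inhabited I;
  directed_refl : forall i, le i i;
  directed_trans : forall i j k, le i j -> le j k -> le i k;
  directed_ub : forall i j, exists k, le i k /\ le j k
}.

Definition net_filter (I : Type) (le : I -> I -> Prop) : set_system I :=
  filter_from setT (fun i => [set j | le i j]).

Definition circ (p : EL) (A : set EL) : set EL := [set eta |
  exists (I : Type) (le : I -> I -> Prop) (g : I -> aut C) (h : I -> EL),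
  [/\ directed le, forall i, A (h i),
      EL_act (g i) @[i --> net_filter le] --> p &
      EL_act (g i) * h i @[i --> net_filter le] --> eta]].

Lemma EL_mulr_continuous (y : EL) : continuous (fun x : EL => x * y).
Proof.
apply: continuous_comp_initial; apply: ptws_continuous => p x.
apply: (@continuous_comp EL {ptws Sc -> Sc} _ (@proj1_sig _ _)
  (fun w : {ptws Sc -> Sc} => w (sval y p))).
  exact: initial_continuous.
exact: (@proj_continuous _ (fun=> Sc)).
Qed.

Lemma EL_act_dense (x : EL) (U : set EL) : nbhs x U -> exists g, U (EL_act g).
Proof.
move=> [_ [[W oW <-] Wx WU]].
have /(_ W) [] := svalP x; first exact: open_nbhs_nbhs.
by move=> _ [[g _ <-] Wg]; exists g; exact: WU.
Qed.

Lemma circ_cofinal (p eta : EL) (A : set EL) (I : Type) (le : I -> I -> Prop)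
    (g : I -> aut C) (h : I -> EL) :
  directed le -> (forall i, exists j, le i j /\ A (h j)) ->
  EL_act (g i) @[i --> net_filter le] --> p ->
  EL_act (g i) * h i @[i --> net_filter le] --> eta -> circ p A eta.
Proof.
move=> dle cof gp geta; pose J := {i | A (h i)}; pose v : J -> I := @proj1_sig _ _.
exists J, (fun i j => le (v i) (v j)), (g \o v), (h \o v).
have sub (U : set I) : net_filter le U ->
    net_filter (fun i j : J => le (v i) (v j)) (v @^-1` U).
  move=> [i0 _ iU]; have [j [ij Aj]] := cof i0.
  exists (exist _ j Aj) => // k jk; apply: iU => /=.
  by apply: (directed_trans dle) ij _.
split.
- split.
  + have [i] := directed_nonempty dle; have [j [_ Aj]] := cof i.
    by constructor; exists j.
  + by move=> i; exact: directed_refl.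
  + by move=> i j k; exact: directed_trans.
  + move=> i j; have [k [ik jk]] := directed_ub dle (v i) (v j).
    have [l [kl Al]] := cof k; exists (exist _ l Al).
    by split; [apply: (directed_trans dle) ik _|apply: (directed_trans dle) jk _].
- by case.
- by move=> U /gp /sub.
- by move=> U /geta /sub.
Qed.

Lemma circS (p : EL) (A B : set EL) : A `<=` B -> circ p A `<=` circ p B.
Proof.
move=> AB eta [I [le [g [h [dle Ah gp geta]]]]].
by exists I, le, g, h; split=> // i; exact: AB.
Qed.

Lemma circU (p : EL) (A B : set EL) :
  circ p (A `|` B) `<=` circ p A `|` circ p B.
Proof.
move=> eta [I [le [g [h [dle ABh gp geta]]]]].
have [cA|ncA] := pselect (forall i, exists j, le i j /\ A (h j)).
  by left; exact: circ_cofinal cA gp geta.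
right; apply: (circ_cofinal dle _ gp geta) => i.
have [i0 i0A] : exists i0, forall j, le i0 j -> ~ A (h j).
  apply: contrapT => H; apply: ncA => i0; apply: contrapT => H0; apply: H.
  by exists i0 => j ij Aj; apply: H0; exists j.
have [k [ik i0k]] := directed_ub dle i i0.
by exists k; split=> //; case: (ABh k) => // /(i0A _ i0k).
Qed.

Section Tau.
Variable D : ellis_datum EL.
Local Notation uM := (ellis_group D).

Definition cl_tau (A : set uM) : set uM :=
  [set p | circ (idem D) [set sval q | q in A] (sval p)].

Lemma cl_tauS (A B : set uM) : A `<=` B -> cl_tau A `<=` cl_tau B.
Proof. by move=> AB p; apply: circS => _ [q /AB Bq <-]; exists q. Qed.

Lemma cl_tauU (A B : set uM) : cl_tau (A `|` B) `<=` cl_tau A `|` cl_tau B.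
Proof. by move=> p H; apply: circU; rewrite -image_setU. Qed.

Lemma cl_tau0 : cl_tau set0 = set0.
Proof.
apply/seteqP; split=> // p [I [le [g [h [dle Ah _ _]]]]].
by have [i] := directed_nonempty dle; have [] := Ah i.
Qed.

Lemma sub_cl_tau (A : set uM) : A `<=` cl_tau A.
Proof.
move=> p Ap; pose I := {U : set EL | nbhs (idem D) U}.
pose g (i : I) := sval (cid (EL_act_dense (svalP i))).
have gI (i : I) : sval i (EL_act (g i)) by rewrite /g; case: cid.
exists I, (fun i j => sval j `<=` sval i), g, (fun=> sval p).
have gu : EL_act (g i) @[i --> net_filter (fun i j : I => sval j `<=` sval i)]
    --> idem D.
  move=> U nU; exists (exist _ U nU) => // j /= jU; exact/jU/gI.
split=> //.
- split=> //.
  + by constructor; exists setT; exact: filterT.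
  + by move=> i x.
  + by move=> i j k ij jk x /jk /ij.
  + move=> [U nU] [V nV].
    by exists (exist _ (U `&` V) (filterI nU nV)); split=> x [].
- by move=> i; exists p.
- rewrite -[X in _ --> X]ellis_idl.
  exact: (cvg_comp _ _ gu (@EL_mulr_continuous (sval p) (idem D))).
Qed.

(* The tau-closed sets are the sets A such that cl_tau A = A. *)
Definition tau_open : set_system uM := [set U | cl_tau (~` U) = ~` U].

Lemma tau_openP (U : set uM) : tau_open U <-> cl_tau (~` U) `<=` ~` U.
Proof.
split=> [->//|H]; apply/seteqP; split=> //; exact: sub_cl_tau.
Qed.

Fact tau_openT : tau_open setT.
Proof. by rewrite /tau_open /= setCT cl_tau0. Qed.

Fact tau_openI : setI_closed tau_open.
Proof.
move=> U V oU oV; apply/tau_openP; rewrite setCI => p /cl_tauU.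
by rewrite oU oV.
Qed.

Fact tau_open_bigU (I : Type) (U : I -> set uM) :
  (forall i, tau_open (U i)) -> tau_open (\bigcup_i U i).
Proof.
move=> oU; apply/tau_openP; rewrite setC_bigcup => p Hp i _.
by rewrite -oU; apply: cl_tauS Hp => q; apply.
Qed.

HB.instance Definition _ :=
  isOpenTopological.Build uM tau_openT tau_openI tau_open_bigU.

Definition H_tau : set uM := \bigcap_(V in nbhs (1 : uM)) cl_tau V.

End Tau.

Lemma tp_c_subproof : exists a : C -> C', tp a = tp c /\ tp_over c c = tp_over a c.
Proof. by exists c. Qed.
Definition tp_c : Sc := exist _ _ tp_c_subproof.

Definition pi0 (x : EL) : Sc := sval x tp_c.

(* sigma' Autf_L, for any sigma' with sigma'(c) realizing pi0 x: see fhatE and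
   fhat_ex. *)
Definition fhat (x : EL) : quot (AutfL C') :=
  coset (AutfL C') (xget 1 [set s : aut C' | tp_over (s \o c) c = sval (pi0 x)]).

Definition incl_small : small_model C' :=
  SmallModel (@incl_elementary _ _ _ C') (degree_bigger C').

Lemma fhatE (x : EL) (s : aut C') :
  tp_over (s \o c) c = sval (pi0 x) -> fhat x = coset (AutfL C') s.
Proof. exact: (@GalL_of_typeE _ _ _ incl_small (pi0 x)). Qed.

Lemma fhat_ex (x : EL) : exists s : aut C', tp_over (s \o c) c = sval (pi0 x).
Proof. exact: (@type_space_aut _ _ _ incl_small (pi0 x)). Qed.

Definition ellis_to_GalL (D : ellis_datum EL) (M : small_model C')
  (p : ellis_group D) : GalL M := fhat (sval p).

End Dynamics.
Arguments EL {L T C} C'.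
Arguments H_tau {L T C C'} D.
Arguments ellis_to_GalL {L T C C'} D M.

Definition Gal0 L (T : theory L) (N : monster T) (M : small_model N) :
  set (GalL M) := closure [set 1].
Arguments Gal0 {L T N} M.

Definition GalKP L (T : theory L) (N : monster T) (M : small_model N) : Type :=
  quot (Gal0 M).
HB.instance Definition _ L (T : theory L) (N : monster T) (M : small_model N) :=
  TopBaseUMagma.on (GalKP M).

Definition continuous_epi (G H : TopBaseUMagma.type) (h : G -> H) : Prop :=
  [/\ continuous h, {morph h : x y / x * y} & forall y, exists x, h x = y].

(* Main.v *)
(* Taking an ultralimit of a net that witnesses [x \in p \circ A] gives
   automorphisms [a], [b] of C' such that [a c] realizes [pi0 p], [b c] realizes
   [pi0 x], and the type of [(a c, b c)] is a limit of types of pairs [(c, t c)]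
   with [t c] realizing [pi0 eta] for some [eta] in [A].  With [p = u] the
   automorphism [a] is Lascar strong, so that [f x] is the class of [a^-1 b],
   whose type over a small model is a limit of types coming from [A]: this is
   the continuity of [f].  With [A = [set y]] one gets that [fhat] is
   multiplicative.

   For [H <= ker f], let [theta] be the set of formulas that hold of all pairs
   of tuples having the same type over some copy of [c].  For each [phi] in
   [theta], the set of [q] such that [pi0 q] contains [phi] is a neighbourhood of
   [u] in the tau-topology, so if [p] belongs to all [cl_tau V], then some
   realizations of [pi0 u] and [pi0 p] satisfy [phi], and by compactness some
   satisfy all of [theta]; such tuples are conjugate by a Lascar strong automorphism.

   Multiplication is separately continuous for the tau-topology, and in a group
   with this property the set of elements that cannot be separated from [1] by
   disjoint open sets is a normal subgroup; this set is [H]. *)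
Require Import Defs.
From HB Require Import structures.
From Stdlib Require List.
From mathcomp Require Import all_boot.
From mathcomp Require Import boolp classical_sets functions cardinality filter.
From mathcomp Require Import topology.

Set Implicit Arguments.
Unset Strict Implicit.
Unset Printing Implicit Defensive.

Local Open Scope classical_set_scope.
Local Open Scope group_scope.

(** * Formulas and saturation *)

(** A maximal partial injection, given by its graph [G], is total on one side; otherwise a pair of
    missed points could be added. *)
Lemma injection_comparable (X Y : Type) :
  (exists h : X -> Y, injective h) \/ (exists h : Y -> X, injective h).
Proof.
pose P := [set G : set (X * Y) | forall a b, G a -> G b -> (a.1 = b.1 <-> a.2 = b.2)].
have [F FP totF|G [PG maxG]] := @Zorn_bigcup _ P.
  move=> a b [A FA Aa] [B FB Bb].
  have [AB|BA] := totF _ _ FA FB.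
    by apply: (FP _ FB) => //; exact: AB.
  by apply: (FP _ FA) => //; exact: BA.
have [/choice[h Gh]|/existsNP[x nx]] := pselect (forall x, exists y, G (x, y)).
  by left; exists h => x y hxy; exact/(PG _ _ (Gh x) (Gh y)).
have [/choice[h Gh]|/existsNP[y ny]] := pselect (forall y, exists x, G (x, y)).
  by right; exists h => y z hyz; exact/(PG _ _ (Gh y) (Gh z)).
exfalso; apply: (maxG (G `|` [set (x, y)])).
  split; first by move=> ?; left.
  by move=> /(_ (x, y) (or_intror erefl)) Gxy; apply: nx; exists y.
move=> [a1 a2] [b1 b2] /= [Ga|[-> ->]] [Gb|[-> ->]] //.
- exact: (PG _ _ Ga Gb).
- by split=> e; subst; exfalso; [apply: nx; exists a2|apply: ny; exists a1].
- by split=> e; subst; exfalso; [apply: nx; exists b2|apply: ny; exists b1].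
Qed.

Lemma smaller_sum2 (X Y Z : Type) : strong_limit Z ->
  smaller X Z -> smaller Y Z -> smaller (X + Y) Z.
Proof.
move=> Zsl XZ YZ; have [[h hI]|[h hI]] := injection_comparable X Y.
  pose k (s : X + Y) : Y + Y := match s with inl x => inl (h x) | inr y => inr y end.
  apply: (@smaller_le _ _ _ k) (smaller_sum Zsl YZ).
  by move=> [x|x] [y|y] //= [] // => [/hI ->|->].
pose k (s : X + Y) : X + X := match s with inl x => inl x | inr y => inr (h y) end.
apply: (@smaller_le _ _ _ k) (smaller_sum Zsl XZ).
by move=> [x|x] [y|y] //= [] // => [->|/hI ->].
Qed.

Lemma smaller_fin (L : language) (T : theory L) (N : monster T) (I : finType) :
  smaller I (degree N).
Proof.
apply: (smaller_le (h := fun i => inr (enum_rank i : nat))) (degree_large N).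
by move=> i j [] /val_inj /enum_rank_inj.
Qed.

Section Formulas.
Context (L : language).
Implicit Types (V : Type) (M : structure L).

Lemma term_fin_support V (t : term L V) :
  exists (I : finType) (e : I -> V) (t' : term L I), t = tsubst_var e t'.
Proof.
elim: t => [x|f ts IH].
  by exists unit, (fun=> x), (Var tt).
pose I k := sval (cid (IH k)); pose H k := cid (svalP (cid (IH k))).
pose e k : I k -> V := sval (H k).
pose t' k : term L (I k) := sval (cid (svalP (H k))).
have tE k : ts k = tsubst_var (e k) (t' k) := svalP (cid (svalP (H k))).
exists {k : 'I_(fun_arity f) & I k}, (fun k => e (tag k) (tagged k)),
  (App (fun k => tsubst_var (fun i => Tagged I i) (t' k))).
congr App; apply/funext => k; rewrite tE.
by elim: (t' k) => //= g us IHu; congr App; apply/funext => l.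
Qed.

Lemma formula_fin_support V (phi : formula L V) :
  exists (I : finType) (e : I -> V) (phi' : formula L I),
    forall M (v : V -> M), sat v phi <-> sat (v \o e) phi'.
Proof.
elim: phi => {V} [V|V s t|V r ts|V a [I [e [a' aE]]] b [J [d [b' bE]]]|V a [I [e [a' aE]]]].
- by exists void, (of_void V), Bot.
- have [I [e [s' ->]]] := term_fin_support s.
  have [J [d [t' ->]]] := term_fin_support t.
  exists (I + J)%type, (fun k => match k with inl i => e i | inr j => d j end),
    (Eqn (tsubst_var inl s') (tsubst_var inr t')) => M v /=.
  by rewrite !eval_subst_var.
- pose S k := cid (term_fin_support (ts k)); pose I k := sval (S k).
  pose H k := cid (svalP (S k)); pose e k : I k -> V := sval (H k).
  pose t' k : term L (I k) := sval (cid (svalP (H k))).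
  have tE k : ts k = tsubst_var (e k) (t' k) := svalP (cid (svalP (H k))).
  exists {k : 'I_(rel_arity r) & I k}, (fun k => e (tag k) (tagged k)),
    (Rel (fun k => tsubst_var (fun i => Tagged I i) (t' k))) => M v /=.
  suff -> : (fun i => Defs.eval v (ts i)) =
    (fun k => Defs.eval (v \o (fun k => e (tag k) (tagged k)))
      (tsubst_var (fun i => Tagged I i) (t' k))) by [].
  by apply/funext => k; rewrite tE !eval_subst_var.
- exists (I + J)%type, (fun k => match k with inl i => e i | inr j => d j end),
    (Imp (subst_var inl a') (subst_var inr b')) => M v /=.
  by rewrite !sat_subst_var aE bE.
(* [J] keeps the indices of free variables; [k] sends every other index to [None], the variable
   bound by [All]. *)
- pose J := {i : I | isSome (e i)}.
  have Je (j : J) : exists x, e (val j) = Some x by case: j => i /=; case: (e i) => // x; exists x.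
  have [d dE] := choice Je.
  pose k i : option J := insub i.
  exists J, d, (All (subst_var k a')) => M v /=.
  suff H x : sat (oapp v x) a <-> sat (oapp (v \o d) x) (subst_var k a').
    by split=> Hx x; exact/H.
  rewrite aE sat_subst_var; suff -> : oapp v x \o e = oapp (v \o d) x \o k by [].
  apply/funext => i /=; rewrite /k; case: insubP => [j _ <- /=|]; first by rewrite dE.
  by case: (e i).
Qed.

(* One variable is quantified out at a time, by renaming it to [None]. *)
Lemma ex_formula_seq V (W : set V) (s : seq V) (phi : formula L V) :
  exists psi : formula L V, forall M (v : V -> M), sat v psi <->
    exists v', (forall i, W i \/ ~ List.In i s -> v' i = v i) /\ sat v' phi.
Proof.
elim: s => [|x s [psi psiE]].
  exists phi => M v; split=> [vphi|[v' [v'v]]]; first by exists v; split.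
  by rewrite (_ : v' = v) //; apply/funext => i; apply: v'v; right.
have [Wx|nWx] := pselect (W x).
  exists psi => M v; rewrite psiE; split=> -[v' [v'v ?]]; exists v'; split=> // i Wi.
    by apply: v'v; case: Wi => [|Wi]; [left|right=> /or_intror/Wi].
  apply: v'v; case: (pselect (W i)) => [|nWi]; first by left.
  by right=> -[xi|]; [apply: nWi; rewrite -xi|case: Wi].
pose h y : option V := if pselect (y = x) then None else Some y.
exists (Neg (All (Neg (subst_var h psi)))) => M v.
pose vx a i : M := if pselect (i = x) then a else v i.
have hE a : oapp v a \o h = vx a.
  by apply/funext => i; rewrite /h /vx /=; case: pselect.
have -> : sat v (Neg (All (Neg (subst_var h psi)))) <-> exists a, sat (vx a) psi.
  split=> /= [/existsNP[a /contrapT]|[a pa] /(_ a)]; rewrite sat_subst_var hE //.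
  by exists a.
split=> [[a /psiE[v' [v'v ?]]]|[v' [v'v v'phi]]].
  exists v'; split=> // i Wi; have ix : i <> x.
    by move=> ix; case: Wi => [|[]]; [rewrite ix|left].
  rewrite v'v /vx; first by case: pselect.
  by case: Wi => [|Wi]; [left|right=> /or_intror/Wi].
exists (v' x); apply/psiE; exists v'; split=> // i Wi; rewrite /vx.
case: pselect => [ix|ix]; first by rewrite /= ix.
apply: v'v.
by case: Wi => [|Wi]; [left|right=> -[/esym|]].
Qed.

(** Only finitely many variables occur in [phi], so all those outside [W], possibly infinitely many,
    can be quantified out. *)
Lemma ex_formula V (W : set V) (phi : formula L V) :
  exists psi : formula L V, forall M (v : V -> M), sat v psi <->
    exists v', (forall i, W i -> v' i = v i) /\ sat v' phi.
Proof.
have [I [e [phi' phiE]]] := formula_fin_support phi.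
have [psi psiE] := ex_formula_seq W [seq e i | i <- enum I] phi.
exists psi => M v; rewrite psiE; split=> -[v' [v'v v'phi]].
  by exists v'; split=> // i Wi; apply: v'v; left.
pose s := [seq e i | i <- enum I].
exists (fun i => if pselect (List.In i s) then v' i else v i); split.
  by move=> i Wi; case: pselect => //= si; case: Wi => [/v'v|].
rewrite phiE (_ : _ \o e = v' \o e) -?phiE //.
apply/funext => i /=; case: pselect => // -[].
have : i \in enum I by rewrite mem_enum.
rewrite /s; elim: (enum I) => //= j l IH; rewrite inE => /orP[/eqP ->|/IH]; first by left.
by right.
Qed.

End Formulas.

(** * Realizing types in a monster model *)

Section Saturation.
Context (L : language) (T : theory L) (N : monster T).

(** Saturation speaks of one variable. By Zorn's lemma there is a maximal partial assignment [G]
    compatible with each formula of [p]; if it missed a variable, saturation over its range would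
    give a value for it. *)
Lemma saturated_realize (I : Type) (p : set (formula L I)) :
  smaller I (degree N) -> p !=set0 ->
  (forall phi psi, p phi -> p psi -> p (And phi psi)) ->
  (forall phi, p phi -> exists v : I -> N, sat v phi) ->
  exists v : I -> N, forall phi, p phi -> sat v phi.
Proof.
move=> Ismall [phi0 pphi0] pAnd psat.
pose ext (G : set (I * N)) (v : I -> N) := forall i x, G (i, x) -> v i = x.
pose P := [set G | forall phi, p phi -> exists2 v, ext G v & sat v phi].
have [F FP totF|G [PG maxG]] := @Zorn_bigcup _ P.
  move=> phi pphi.
  have [[G0 FG0]|F0] := pselect (exists G, F G); last first.
    have [v vphi] := psat _ pphi; exists v => // i x [G FG].
    by exfalso; apply: F0; exists G.
  pose U := \bigcup_(G in F) G.
  have Ufun i x y : U (i, x) -> U (i, y) -> x = y.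
    move=> [A FA Ax] [B FB By].
    have [AB|BA] := totF _ _ FA FB.
      by have [v ev _] := FP _ FB _ pphi; rewrite -(ev _ _ (AB _ Ax)) (ev _ _ By).
    by have [v ev _] := FP _ FA _ pphi; rewrite -(ev _ _ Ax) (ev _ _ (BA _ By)).
  have [J [e [phi' phiE]]] := formula_fin_support phi.
  (* A formula has finitely many variables, so one member of the chain already contains the part of
     the union that concerns it. *)
  have [G FG GU] : exists2 G, F G & forall j, j \in enum J -> forall x, U (e j, x) -> G (e j, x).
    elim: (enum J) => [|j l [G FG IH]]; first by exists G0.
    have [[x Ux]|nU] := pselect (exists x, U (e j, x)); last first.
      exists G => // k; rewrite inE => /orP[/eqP -> x Ux|/IH //].
      by exfalso; apply: nU; exists x.
    have [A FA Ax] := Ux.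
    have [AG|GA] := totF _ _ FA FG.
      exists G => // k; rewrite inE => /orP[/eqP -> y Uy|/IH //].
      by rewrite (Ufun _ _ _ Uy Ux); exact: AG.
    exists A => // k; rewrite inE => /orP[/eqP -> y Uy|/IH H y /H /GA //].
    by rewrite (Ufun _ _ _ Uy Ux).
  have [v ev vphi] := FP _ FG _ pphi.
  pose v' i := if pselect (exists x, U (i, x)) is left H then sval (cid H) else v i.
  exists v' => [i x Ux|].
    rewrite /v'; case: pselect => [H|[]]; last by exists x.
    by case: cid => y Uy /=; exact: Ufun Uy Ux.
  apply/phiE; rewrite (_ : v' \o e = v \o e); first exact/phiE.
  apply/funext => j /=; rewrite /v'; case: pselect => // H; case: cid => y Uy /=.
  by rewrite (ev _ y) //; apply: GU => //; rewrite mem_enum.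
have Gfun i x y : G (i, x) -> G (i, y) -> x = y.
  by have [v ev _ /ev <- /ev] := PG _ pphi0.
have [/choice[v Gv]|/existsNP[i0 ni0]] := pselect (forall i, exists x, G (i, x)).
  exists v => phi /PG[w ew]; rewrite (_ : v = w) //.
  by apply/funext => i; rewrite (ew _ _ (Gv i)).
pose A := [set x | exists i, G (i, x)].
have Asmall : smaller A (degree N).
  have [h hE] := choice (fun a : A => set_mem (valP a) : exists i, G (i, val a)).
  apply: (smaller_le (h := h)) Ismall => a b hab; apply: val_inj.
  by apply: (Gfun (h a) _ _ (hE a)); rewrite hab; exact: hE.
(* Assigned variables become parameters, all others the single unknown. Identifying these is
   harmless: [ex phi] depends only on [i0] and the assigned variables. *)
pose k i : unit + A :=
  if pselect (exists x, G (i, x)) is left H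
  then inr (exist _ (sval (cid H)) (mem_set (ex_intro _ i (svalP (cid H))))) else inl tt.
pose w (t : unit -> N) : I -> N := tuple_cat t (@set_val _ A) \o k.
have wi0 t : w t i0 = t tt by rewrite /w /k /=; case: pselect.
have wG t : ext G (w t).
  move=> i x Gx; rewrite /w /k /=; case: pselect => [H|[]]; last by exists x.
  by rewrite /=; case: cid => y Gy; exact: Gfun Gy Gx.
pose W := [set i | i = i0 \/ exists x, G (i, x)].
have [ex exE] := choice (@ex_formula L I W).
pose q := [set psi | exists2 phi, p phi & psi = subst_var k (ex phi)].
have qsat t phi : tp_over t (@set_val _ A) (subst_var k (ex phi)) <->
    exists v', [/\ v' i0 = t tt, ext G v' & sat v' phi].
  rewrite /tp_over /tp /= sat_subst_var exE; split=> -[v' []].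
    move=> v'w v'phi; exists v'; split=> //; first by rewrite v'w; [exact: wi0|left].
    by move=> i x Gx; rewrite v'w; [exact: wG|right; exists x].
  move=> v'i0 ev' v'phi; exists v'; split=> // i [->|[x Gx]]; first by rewrite v'i0; exact/esym/wi0.
  by rewrite (ev' _ _ Gx); exact/esym/wG.
have [|t qt] := monster_saturated Asmall (p := q).
  move=> n s qs; have [phi [pphi sphi]] : exists phi, p phi /\
      forall j t, tp_over t (@set_val _ A) (subst_var k (ex phi)) ->
      tp_over t (@set_val _ A) (s j).
    elim: n s qs => [|n IH] s qs; first by exists phi0; split=> // -[].
    have [phi [pphi sphi]] := IH (fun j => s (lift ord0 j)) (fun j => qs _).
    have [psi ppsi s0] := qs ord0.
    exists (And phi psi); split; first exact: pAnd.
    move=> j t /qsat[v' [v'i ev' v'phi]].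
    have [v'1 v'2] : sat v' phi /\ sat v' psi.
      by move: v'phi => /=; split; apply: contrapT; tauto.
    case: (unliftP ord0 j) => [j' ->|->]; first by apply: sphi; apply/qsat; exists v'.
    by rewrite s0; apply/qsat; exists v'.
  have [v ev vphi] := PG _ pphi.
  by exists (fun=> v i0) => j; apply: sphi; apply/qsat; exists v.
exfalso; apply: (maxG (G `|` [set (i0, t tt)])).
  split; first by move=> ?; left.
  by move=> /(_ _ (or_intror erefl)) Gt; apply: ni0; exists (t tt).
move=> phi pphi; have /qsat[v' [v'i ev' v'phi]] := qt _ (ex_intro2 _ _ phi pphi erefl).
by exists v' => // i x [/ev'|[-> ->]].
Qed.

Lemma tp_complete (I : Type) (M M' : structure L) (a : I -> M) (b : I -> M') :
  (forall phi, sat a phi -> sat b phi) -> tp a = tp b.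
Proof.
move=> ab; apply/seteqP; split=> phi; first exact: ab.
by apply: contraPP => na; have := ab (Neg phi) na.
Qed.

(** The formulas true for [F]-almost all [k] form a complete, finitely satisfiable type in the
    variables [I + J]. A realization has the type of [b] on [J], and homogeneity moves that part
    onto [b] itself. *)
Lemma ultra_realize (I J K : Type) (F : set_system K) {FF : UltraFilter F}
    (X : K -> I -> N) (b : J -> N) : smaller I (degree N) -> smaller J (degree N) ->
  exists Y : I -> N, forall phi,
    tp_over Y b phi <-> F [set k | tp_over (X k) b phi].
Proof.
move=> Ismall Jsmall.
have IJsmall := smaller_sum2 (@degree_strong_limit _ _ N) Ismall Jsmall.
pose p := [set phi | F [set k | tp_over (X k) b phi]].
have pneg phi : p phi \/ p (Neg phi) := in_ultra_setVsetC [set k | tp_over (X k) b phi] FF.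
have [|phi psi pphi ppsi|phi /filter_ex[k Xk]|v vp] := saturated_realize (p := p) IJsmall.
- exists (Neg Bot); apply: filterS filterT => k _ /=; exact: id.
- by apply: filterS2 pphi ppsi => k; rewrite /tp_over /tp /=; tauto.
- by exists (tuple_cat (X k) b).
have vpE phi : sat v phi <-> p phi.
  split; last exact: vp.
  by case: (pneg phi) => [|/vp nv /nv].
have vb : tp (v \o inr) = tp b.
  apply/tp_complete => phi; rewrite -sat_subst_var vpE /p /= /tp_over /tp /=.
  by move=> /filter_ex[k]; rewrite /= sat_subst_var.
have [s sb] := monster_homogeneous Jsmall vb.
exists (s \o v \o inl) => phi; rewrite -[X in _ <-> X]vpE -(sat_aut s).
suff -> : s \o v = tuple_cat (s \o v \o inl) b by [].
by apply/funext => -[//|j]; have /(congr1 (fun h => h j)) := sb.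
Qed.

End Saturation.

(** * The group GalL and its topology *)

(** Compactness: closure of [p] under conjunction makes the sets [R k phi] generate a proper filter,
    which extends to an ultrafilter. *)
Lemma ultra_of_types (L : language) (I K : Type) (p : set (formula L I))
    (R : K -> formula L I -> Prop) :
  p !=set0 -> (forall phi psi, p phi -> p psi -> p (And phi psi)) ->
  (forall k phi psi, R k (And phi psi) -> R k phi /\ R k psi) ->
  (forall phi, p phi -> exists k, R k phi) ->
  exists F : set_system K, UltraFilter F /\ forall phi, p phi -> F [set k | R k phi].
Proof.
move=> [phi0 p0] pAnd RAnd pR.
pose B := filter_from p (fun phi => [set k | R k phi]).
have BP : ProperFilter B.
  apply: filter_from_proper => [|phi /pR//].
  apply: filter_from_filter; first by exists phi0.
  move=> phi psi pphi ppsi; exists (And phi psi); first exact: pAnd.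
  by move=> k /RAnd.
have [F [FU BF]] := ultraFilterLemma BP.
by exists F; split=> // phi pphi; apply: BF; exists phi.
Qed.

Section Cosets.
Context (G : groupType) (N : set G).
Hypothesis Nsub : subgroup N.
Hypothesis Nnormal : forall x n, N n -> N (x * n * x^-1).

Lemma coset_eqP (x y : G) : coset N x = coset N y <-> N (x^-1 * y).
Proof.
have [N1 NM NV] := Nsub; split=> [/eqquotP/asboolP xy|xy].
  have : lcoset N y y by exists 1 => //; rewrite mulg1.
  by rewrite -xy => -[n Nn <-]; rewrite mulKg.
apply/eqquotP/asboolP/seteqP; split=> _ [n Nn <-].
  exists ((x^-1 * y)^-1 * n); first exact/NM/Nn/NV.
  by rewrite invgM invgK !mulgA mulgV mul1g.
exists (x^-1 * y * n); first exact: NM.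
by rewrite !mulgA mulgV mul1g.
Qed.

Lemma coset_repr (X : quot N) : coset N (repr X) = X.
Proof. exact: reprK. Qed.

Lemma cosetM : {morph coset N : x y / x * y}.
Proof.
have [N1 NM NV] := Nsub.
move=> x y; apply/coset_eqP.
have /coset_eqP xx := esym (coset_repr (coset N x)).
have /coset_eqP yy := esym (coset_repr (coset N y)).
set x' := repr _ in xx *; set y' := repr _ in yy *.
have -> : (x * y)^-1 * (x' * y') = (y^-1 * (x^-1 * x') * y^-1^-1) * (y^-1 * y').
  by rewrite invgM invgK !mulgA mulgK.
by apply: NM => //; exact: Nnormal.
Qed.

End Cosets.

Lemma type_space_sat (L : language) (M N : structure L) (m : M -> N)
  (p : type_space m) : exists a : M -> N, tp a = tp m /\ sval p = tp_over a m.
Proof. by case: p => p [a H]; exists a. Qed.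

Section GalLGroup.
Context (L : language) (T : theory L) (N : monster T).

Let cN := coset (AutfL N).

Lemma cosetLP (s t : aut N) : cN s = cN t <-> AutfL N (s^-1 * t).
Proof. exact/coset_eqP/AutfL_subgroup. Qed.

Lemma cosetLM (s t : aut N) : cN (s * t) = cN s * cN t.
Proof. by apply: cosetM => [|x n]; [exact: AutfL_subgroup|exact: AutfL_normal]. Qed.

Lemma cosetL_surj (X : quot (AutfL N)) : exists s, cN s = X.
Proof. by exists (repr X); exact: coset_repr. Qed.

Context (M : small_model N).
Local Notation m := (small_incl M).

Definition GalL_inv (X : GalL M) : GalL M := cN (repr X)^-1.

Lemma GalL_invE (s : aut N) : GalL_inv (cN s) = cN s^-1.
Proof.
have /cosetLP H := coset_repr (cN s); apply/cosetLP.
rewrite invgK; have [_ _ V] := AutfL_subgroup N.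
have := AutfL_normal s (V _ H); rewrite invgM invgK !mulgA.
by rewrite mulgV mul1g.
Qed.

Fact GalL_mulA : associative (fun X Y : GalL M => X * Y).
Proof.
move=> X Y Z; have [s <-] := cosetL_surj X; have [t <-] := cosetL_surj Y.
have [r <-] := cosetL_surj Z.
by have := congr1 cN (mulgA s t r); rewrite !cosetLM.
Qed.

Fact GalL_mul1 : left_id 1 (fun X Y : GalL M => X * Y).
Proof.
move=> X; have [s <-] := cosetL_surj X.
by have := congr1 cN (mul1g s); rewrite cosetLM.
Qed.

Fact GalL_1mul : right_id 1 (fun X Y : GalL M => X * Y).
Proof.
move=> X; have [s <-] := cosetL_surj X.
by have := congr1 cN (mulg1 s); rewrite cosetLM.
Qed.

Fact GalL_mulV : left_inverse 1 GalL_inv (fun X Y : GalL M => X * Y).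
Proof.
move=> X; have [s <-] := cosetL_surj X; rewrite GalL_invE.
by have := congr1 cN (mulVg s); rewrite cosetLM.
Qed.

Fact GalL_Vmul : right_inverse 1 GalL_inv (fun X Y : GalL M => X * Y).
Proof.
move=> X; have [s <-] := cosetL_surj X; rewrite GalL_invE.
by have := congr1 cN (mulgV s); rewrite cosetLM.
Qed.

HB.instance Definition _ := Magma_isSemigroup.Build (GalL M) GalL_mulA.
HB.instance Definition _ :=
  BaseUMagma_isUMagma.Build (GalL M) GalL_mul1 GalL_1mul.
HB.instance Definition _ := hasInv.Build (GalL M) GalL_inv.
HB.instance Definition _ := Monoid_isGroup.Build (GalL M) GalL_mulV GalL_Vmul.

End GalLGroup.

Section GalLTopology.
Context (L : language) (T : theory L) (N : monster T) (M : small_model N).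
Local Notation m := (small_incl M).
Local Notation cM := (coset (AutfL N) : aut N -> GalL M).

(** Every type in the space is that of [s m] for an automorphism [s], so the quotient topology can
    be read on automorphisms. *)
Lemma GalL_openP (U : set (GalL M)) : open U <->
  forall s, U (cM s) -> exists phi, tp_over (s \o m) m phi /\
    forall t : aut N, tp_over (t \o m) m phi -> U (cM t).
Proof.
rewrite -[open U]/(open (@GalL_of_type _ _ _ M @^-1` U)) type_openE; split=> [oU s Us|H p].
  have Hs : exists a : M -> N, tp a = tp m /\ tp_over (s \o m) m = tp_over a m.
    by exists (s \o m); split=> //; exact: tp_aut.
  have Es := GalL_of_typeE (p := exist _ _ Hs : type_space m) erefl.
  have [|phi [sphi sU]] := oU (exist _ _ Hs); first by rewrite /= Es.
  exists phi; split=> // t tphi.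
  have Ht : exists a : M -> N, tp a = tp m /\ tp_over (t \o m) m = tp_over a m.
    by exists (t \o m); split=> //; exact: tp_aut.
  have Et := GalL_of_typeE (p := exist _ _ Ht : type_space m) erefl.
  by have := sU (exist _ _ Ht) tphi; rewrite /= Et.
have [s sp] := type_space_aut p.
rewrite /= (GalL_of_typeE sp) => /H[phi [sphi sU]]; exists phi.
split; first by rewrite -sp.
move=> q qphi /=; have [t tq] := type_space_aut q.
by rewrite (GalL_of_typeE tq); apply: sU; rewrite tq.
Qed.

(** Applying [t] to [(t^-1 m, m)] gives [(m, t m)]; thus inversion amounts to exchanging the two
    blocks of variables. *)
Lemma GalL_inv_open (U : set (GalL M)) : open U -> open [set X | U X^-1].
Proof.
move=> /GalL_openP oU; apply/GalL_openP => s /= Us.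
have [|phi [sphi sU]] := oU s^-1; first by rewrite -GalL_invE.
pose k (x : M + M) : M + M := match x with inl i => inr i | inr i => inl i end.
have kE (t : aut N) :
    tp_over (t \o m) m (subst_var k phi) <-> tp_over (t^-1%g \o m) m phi.
  rewrite /tp_over /tp /= sat_subst_var -[X in _ <-> X](sat_aut t).
  suff -> : t \o tuple_cat (t^-1%g \o m) m = tuple_cat (t \o m) m \o k by [].
  by apply/funext => -[i|i] //=; rewrite aut_invK.
exists (subst_var k phi); split; first exact/kE.
by move=> t /kE/sU; rewrite -GalL_invE.
Qed.

(** If openness failed at [s], there would be automorphisms [r], with the class of [r t] outside
    [U], such that the type of [r m] over [m] tends to that of [s m]. The limit of the pairs
    [(r m, r t m)] has the form [(a m, a t m)] with [a] in the coset of [s]. So the class of [a t]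
    is in [U], and openness there puts that of some [r t] into [U]. *)
Lemma GalL_mulr_open (U : set (GalL M)) Y : open U -> open [set X | U (X * Y)].
Proof.
have [t <-] := cosetL_surj Y; move=> /GalL_openP oU; apply/GalL_openP => s /= Us.
have {Us} : U (cM (s * t)) by rewrite cosetLM.
move=> Us; apply: contrapT => nH.
pose p : set (formula L (M + M)) := tp_over (s \o m) m.
pose R (r : aut N) phi := tp_over (r \o m) m phi /\ ~ U (cM (r * t)).
have [|phi psi||phi pphi|F [FF FR]] := @ultra_of_types L _ _ p R.
- by exists (Neg Bot) => /=.
- by rewrite /p /tp_over /tp /=; tauto.
- move=> k phi psi [H nU]; split; split=> //; apply: contrapT;
  move: H; rewrite /tp_over /tp /=; tauto.
- apply: contrapT => nR; apply: nH; exists phi; split=> // r rphi.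
  by rewrite -cosetLM; apply: contrapT => nU; apply: nR; exists r.
have Msmall := small_small M.
have MMsmall := smaller_sum2 (@degree_strong_limit _ _ N) Msmall Msmall.
have [Y0 YE] := ultra_realize
  (fun r : aut N => tuple_cat (r \o m) (r \o t \o m)) m MMsmall Msmall.
have tY : tp (tuple_cat m (t \o m)) = tp Y0.
  apply: tp_complete => phi mphi.
  have /YE : F [set k : aut N | tp_over (tuple_cat (k \o m) (k \o t \o m)) m
      (subst_var inl phi)].
    apply: filterS filterT => k _ /=; rewrite /tp_over /tp /= sat_subst_var.
    suff -> : tuple_cat (tuple_cat (k \o m) (k \o t \o m)) m \o inl =
       k \o tuple_cat m (t \o m) by rewrite sat_aut.
    by apply/funext => -[].
  by rewrite /tp_over /tp /= sat_subst_var.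
have [a aY] := monster_homogeneous MMsmall tY.
have as_ : cM a = cM s.
  apply: (tp_over_coset (M := M)); apply/esym/tp_complete => phi sphi.
  pose k (x : M + M) : (M + M) + M :=
    match x with inl i => inl (inl i) | inr i => inr i end.
  have /YE : F [set k' : aut N | tp_over (tuple_cat (k' \o m) (k' \o t \o m)) m
      (subst_var k phi)].
    apply: filterS (FR _ sphi) => r [rphi _] /=; rewrite /tp_over /tp /= sat_subst_var.
    suff -> : tuple_cat (tuple_cat (r \o m) (r \o t \o m)) m \o k =
      tuple_cat (r \o m) m by [].
    by apply/funext => -[].
  rewrite /tp_over /tp /= sat_subst_var -aY.
  suff -> : tuple_cat (a \o tuple_cat m (t \o m)) m \o k = tuple_cat (a \o m) m by [].
  by apply/funext => -[].
have [|phi [aphi aU]] := oU (a * t).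
  by move: Us; rewrite !cosetLM as_.
pose k (x : M + M) : (M + M) + M :=
  match x with inl i => inl (inr i) | inr i => inr i end.
have : tp_over Y0 m (subst_var k phi).
  rewrite /tp_over /tp /= sat_subst_var -aY.
  suff -> : tuple_cat (a \o tuple_cat m (t \o m)) m \o k =
     tuple_cat ((a * t)%g \o m) m by [].
  by apply/funext => -[].
have pT : p (Neg Bot) by rewrite /p /tp_over /tp /=.
move=> /YE => Fk; have [r [/= rphi [_ nU]]] := filter_ex (filterI Fk (FR _ pT)).
apply/nU/aU; move: rphi; rewrite /tp_over /tp /= sat_subst_var.
suff -> : tuple_cat (tuple_cat (r \o m) (r \o t \o m)) m \o k =
   tuple_cat ((r * t)%g \o m) m by [].
by apply/funext => -[].
Qed.

(** [Y X] is the inverse of [X^-1 Y^-1]. *)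
Lemma GalL_mull_open (U : set (GalL M)) Y : open U -> open [set X | U (Y * X)].
Proof.
move=> /GalL_inv_open/(@GalL_mulr_open _ Y^-1)/GalL_inv_open.
suff -> : [set X | [set X1 | [set X2 | U X2^-1] (X1 * Y^-1)] X^-1] =
  [set X | U (Y * X)] by [].
by apply/seteqP; split=> X /=; rewrite invgM !invgK.
Qed.

Lemma Gal0P (Y : GalL M) : Gal0 M Y <-> forall U, open U -> U Y -> U 1.
Proof.
split=> [H U oU UY|H U].
  by have [_ [-> //]] := H U (open_nbhs_nbhs (conj oU UY)).
rewrite nbhsE => -[V [oV VY] VU]; exists 1; split=> //; apply: VU; exact: H oV VY.
Qed.

(** For products separate continuity suffices: an open set containing [X Y] contains [Y], by
    translation and the property of [X], and hence 1. *)
Lemma Gal0_subgroup : subgroup (Gal0 M).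
Proof.
split; first by apply/Gal0P.
- move=> X Y /Gal0P HX /Gal0P HY; apply/Gal0P => U oU UXY.
  apply: HY => //; rewrite -[Y]mul1g.
  exact: HX (@GalL_mulr_open U Y oU) UXY.
- move=> X /Gal0P HX; apply/Gal0P => U oU UX.
  by have := HX _ (GalL_inv_open oU) UX; rewrite /= invg1.
Qed.

Lemma Gal0_normal (X Y : GalL M) : Gal0 M Y -> Gal0 M (X * Y * X^-1).
Proof.
move=> /Gal0P HY; apply/Gal0P => U oU UXY.
have := HY _ (@GalL_mull_open _ X (@GalL_mulr_open _ X^-1 oU)) UXY.
by rewrite /= mulg1 mulgV.
Qed.

End GalLTopology.

Lemma coset_epi (G : TopBaseUMagma.type) (N : set G) :
  {morph coset N : x y / x * y} -> continuous_epi (coset N : G -> quot N).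
Proof.
move=> cM; split=> //; first exact/continuousP.
by move=> X; exists (repr X); exact: reprK.
Qed.

(** * The circle operation *)

Section Ellis.
Context (L : language) (T : theory L) (C : monster T) (C' : bigger_monster C).
Local Notation c := (Defs.incl C').
Local Notation EL := (EL C').
Local Notation Sc := (Sc C').
Local Notation cL := (coset (AutfL C')).

Lemma EL_eval_continuous (q : Sc) : continuous (fun x : EL => sval x q).
Proof.
move=> x; apply: (@continuous_comp EL {ptws Sc -> Sc} _ (@proj1_sig _ _)
  (fun w : {ptws Sc -> Sc} => w q)).
  exact: initial_continuous.
exact: (@proj_continuous _ (fun=> Sc)).
Qed.

Lemma cvg_Sc (F : set_system Sc) (p : Sc) : Filter F ->
  (forall phi, sval p phi -> F [set q | sval q phi]) -> F --> p.
Proof.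
move=> FF Fp U; rewrite nbhsE => -[V [oV Vp] VU].
have [phi [pphi sV]] := oV _ Vp.
by apply: filterS (Fp _ pphi) => q /sV/VU.
Qed.

Lemma nbhs_Sc (p : Sc) phi : sval p phi -> nbhs p [set q : Sc | sval q phi].
Proof.
move=> pphi; apply: open_nbhs_nbhs; split=> //.
by move=> q qphi; exists phi; split.
Qed.

Lemma pi0_act (g : aut C) (s : aut C') : s \o c = c \o g ->
  sval (pi0 (EL_act C' g)) = tp_over (s \o c) c.
Proof. by move=> /act_set_tp <-. Qed.

Lemma pi0_actM (g : aut C) (s t : aut C') (x : EL) : s \o c = c \o g ->
  tp_over (t \o c) c = sval (pi0 x) ->
  sval (pi0 (EL_act C' g * x)) = tp_over ((s * t)%g \o c) c.
Proof. by move=> /act_set_tp sg tx; rewrite -[LHS]/(act_set g (sval (pi0 x))) -tx sg. Qed.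

Lemma C_small : smaller C (degree C').
Proof. exact: degree_bigger. Qed.

Lemma sum_small I J : smaller I (degree C') -> smaller J (degree C') ->
  smaller (I + J) (degree C').
Proof. exact/smaller_sum2/degree_strong_limit. Qed.

(* Along the nets witnessing [x \in p \circ A], the types over [c] of
   [(s_i (c, w), s_i t_i (c, w))] accumulate at the type of a tuple that
   homogeneity brings to the form [(a (c, w), b (c, w))]. *)
Lemma circ_realize (J : Type) (w : J -> C') (p x : EL) (A : set EL) :
  smaller J (degree C') -> circ p A x -> exists a b : aut C',
  [/\ tp_over (a \o c) c = sval (pi0 p), tp_over (b \o c) c = sval (pi0 x) &
      forall phi, sat (tuple_cat (b \o w) (a \o w)) phi ->
      exists eta (t : aut C'),
        [/\ A eta, tp_over (t \o c) c = sval (pi0 eta) & tp_over (t \o w) w phi]].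
Proof.
move=> Jsmall [K [le [g [h [dle Ah gp gx]]]]].
have NP : ProperFilter (net_filter le).
  apply: filter_from_proper => [|i _]; last by exists i; exact: (directed_refl dle).
  apply: filter_from_filter; first by have [i] := directed_nonempty dle; exists i.
  move=> i j _ _; have [k [ik jk]] := directed_ub dle i j; exists k => // l kl.
  by split; [apply: (directed_trans dle) ik kl|apply: (directed_trans dle) jk kl].
have [F [FU NF]] := ultraFilterLemma NP.
have [s sE] := choice (fun i => aut_extends C' (g i)).
have [t tE] := choice (fun i => fhat_ex (h i)).
pose cw := tuple_cat c w.
have cw_small := sum_small C_small Jsmall.
pose X i := tuple_cat (s i \o cw) ((s i * t i)%g \o cw).
have [Y YE] := ultra_realize X c (sum_small cw_small cw_small) C_small.
have {}YE V (k : V -> ((C + J) + (C + J)) + C) phi :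
    sat (tuple_cat Y c \o k) phi <-> F [set i | sat (tuple_cat (X i) c \o k) phi].
  rewrite -sat_subst_var [X in X <-> _]YE.
  suff -> : [set i | tp_over (X i) c (subst_var k phi)] =
    [set i | sat (tuple_cat (X i) c \o k) phi] by [].
  by apply/seteqP; split=> i; rewrite /tp_over /tp /= sat_subst_var.
(* Each [s i \o cw] has the type of [cw], hence so has the limit, and homogeneity yields [a]; [b] is
   found likewise. *)
have [a aY] : exists a : aut C', a \o cw = Y \o inl.
  apply: (monster_homogeneous cw_small); apply: tp_complete => phi cwphi.
  apply/(YE _ (inl \o inl)); apply: filterS filterT => i _ /=.
  by rewrite -(sat_aut (s i)) in cwphi.
have [b bY] : exists b : aut C', b \o cw = Y \o inr.
  apply: (monster_homogeneous cw_small); apply: tp_complete => phi cwphi.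
  apply/(YE _ (inl \o inr)); apply: filterS filterT => i _ /=.
  by rewrite -(sat_aut (s i * t i)) in cwphi.
pose k (f : C + J -> (C + J) + (C + J)) (z : C + C) : ((C + J) + (C + J)) + C :=
  match z with inl i => inl (f (inl i)) | inr i => inr i end.
(* As [F] refines the net filter, each half of the limit tuple realizes the limit of the types
   [pi0 (z i)]. *)
have lim (y : EL) (z : K -> EL) (r : aut C') f : r \o cw = Y \o f ->
    (forall i, sval (pi0 (z i)) = tp_over (X i \o f \o inl) c) ->
    z i @[i --> net_filter le] --> y -> tp_over (r \o c) c = sval (pi0 y).
  move=> rY zE zy; have [d [_ yd]] := type_space_sat (pi0 y); rewrite yd.
  apply/esym/tp_complete => phi dphi.
  have rE : tuple_cat (r \o c) c = tuple_cat Y c \o k f.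
    by apply/funext => -[i|//]; have /(congr1 (fun h => h (inl i))) := rY.
  rewrite rE; apply/YE; apply: NF.
  have yphi : sval (pi0 y) phi by rewrite yd.
  have : net_filter le [set i | sval (pi0 (z i)) phi] :=
    zy _ (EL_eval_continuous (nbhs_Sc yphi)).
  apply: filterS => i /=; rewrite zE /tp_over /tp /=.
  suff -> : tuple_cat (X i \o f \o inl) c = tuple_cat (X i) c \o k f by [].
  by apply/funext => -[].
exists a, b; split.
- by apply: lim aY _ gp => i; rewrite (pi0_act (sE i)).
- by apply: lim bY _ gx => i; rewrite (pi0_actM (sE i) (tE i)).
- pose l (z : J + J) : ((C + J) + (C + J)) + C :=
    match z with inl j => inl (inr (inr j)) | inr j => inl (inl (inr j)) end.
  have -> : tuple_cat (b \o w) (a \o w) = tuple_cat Y c \o l.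
    apply/funext => -[j|j].
      by have /(congr1 (fun h => h (inr j))) := bY.
    by have /(congr1 (fun h => h (inr j))) := aY.
  move=> phi /YE/filter_ex[i /= Xphi]; exists (h i), (t i); split=> //.
  (* Removing [s i] from [(s i t i w, s i w)] leaves [(t i w, w)]. *)
  rewrite /tp_over /tp /= -(sat_aut (s i)).
  suff -> : s i \o tuple_cat (t i \o w) w = tuple_cat (X i) c \o l by [].
  by apply/funext => -[].
Qed.

(** To return from neighbourhoods to nets, pairs of neighbourhoods of [p] and [x], ordered by
    reverse inclusion, serve as indices. *)
Lemma circP (p x : EL) (A : set EL) : circ p A x <->
  forall U W, open_nbhs p U -> open_nbhs x W ->
    exists g y, [/\ A y, U (EL_act C' g) & W (EL_act C' g * y)].
Proof.
split=> [[K [le [g [h [dle Ah gp gx]]]]] U W pU xW|H].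
  have [i _ iU] := gp _ (open_nbhs_nbhs pU).
  have [j _ jW] := gx _ (open_nbhs_nbhs xW).
  have [k [ik jk]] := directed_ub dle i j.
  by exists (g k), (h k); split; [|exact: iU|exact: jW].
pose K := {UW : set EL * set EL | open_nbhs p UW.1 /\ open_nbhs x UW.2}.
have /choice[f fE] (k : K) : exists gy : aut C * EL,
    [/\ A gy.2, (sval k).1 (EL_act C' gy.1) & (sval k).2 (EL_act C' gy.1 * gy.2)].
  by case: k => -[U W] [pU xW]; have [g [y ?]] := H _ _ pU xW; exists (g, y).
pose le (k l : K) := (sval l).1 `<=` (sval k).1 /\ (sval l).2 `<=` (sval k).2.
have oT z : open_nbhs z (setT : set EL) by split; [exact: openT|].
exists K, le, (fun k => (f k).1), (fun k => (f k).2); split.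
- split.
  + by constructor; exists (setT, setT).
  + by move=> k; split.
  + move=> i j k [ij ij'] [jk jk'].
    by split; [exact: subset_trans ij|exact: subset_trans ij'].
  + move=> [[U W] [pU xW]] [[U' W'] [pU' xW']].
    have HI : open_nbhs p (U `&` U') /\ open_nbhs x (W `&` W').
      by split; exact: open_nbhsI.
    by exists (exist _ (U `&` U', W `&` W') HI); split; split=> ? [].
- by move=> k; have [] := fE k.
- move=> U'; rewrite nbhsE => -[U pU UU'].
  exists (exist _ (U, setT) (conj pU (oT x))) => //.
  by move=> k [kU _]; have [_ /kU/UU'] := fE k.
- move=> W'; rewrite nbhsE => -[W xW WW'].
  exists (exist _ (setT, W) (conj (oT p) xW)) => //.
  by move=> k [_ kW]; have [_ _ /kW/WW'] := fE k.
Qed.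

Lemma EL_actl_continuous g : continuous (fun x : EL => EL_act C' g * x).
Proof.
apply: continuous_comp_initial; apply: ptws_continuous => p x.
apply: (@continuous_comp EL Sc Sc (fun w : EL => sval w p) (act g)).
  exact: EL_eval_continuous.
exact: act_continuous.
Qed.

Lemma EL_actM g h : EL_act C' (g * h) = EL_act C' g * EL_act C' h.
Proof. by apply: EL_ext; exact: actM. Qed.

Lemma open_nbhs_preimage (X Y : topologicalType) (f : X -> Y) (x : X) U :
  continuous f -> open_nbhs (f x) U -> open_nbhs x (f @^-1` U).
Proof. by move=> /continuousP cf [/cf]. Qed.

(** First [g] near [p] and [y] in [circ q A] are chosen with [g q] near [p q] and [g y] near [x].
    Left multiplication by [g] is continuous, so [h] near [q] and [z] in [A] can be chosen so that
    [g h] and [z] serve. *)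
Lemma circ_circ (p q : EL) (A : set EL) : circ p (circ q A) `<=` circ (p * q) A.
Proof.
move=> x /circP H; apply/circP => U W pqU xW.
have [g [y [/circP yA gU gW]]] :=
  H _ _ (open_nbhs_preimage (@EL_mulr_continuous _ _ _ _ q) pqU) xW.
have [h [z [Az hU hW]]] := yA _ _
  (open_nbhs_preimage (EL_actl_continuous (g := g)) (conj pqU.1 gU))
  (open_nbhs_preimage (EL_actl_continuous (g := g)) (conj xW.1 gW)).
by exists (g * h), z; split=> //; rewrite EL_actM -?mulgA.
Qed.

Lemma circ_mul (p y : EL) (A : set EL) : A y -> circ p A (p * y).
Proof.
move=> Ay; apply/circP => U W pU pyW.
have pW := open_nbhs_preimage (@EL_mulr_continuous _ _ _ _ y) pyW.
have [g [? ?]] := EL_act_dense (open_nbhs_nbhs (open_nbhsI pU pW)).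
by exists g, y.
Qed.

Lemma circ_mulr (p x y : EL) (A : set EL) :
  circ p A x -> circ p [set z * y | z in A] (x * y).
Proof.
move=> /circP H; apply/circP => U W pU xyW.
have [g [z [Az gU gW]]] :=
  H _ _ pU (open_nbhs_preimage (@EL_mulr_continuous _ _ _ _ y) xyW).
by exists g, (z * y); split=> //; [exists z|rewrite mulgA].
Qed.

(** The pair [(b c, a c)] has the type of [(t c, c)] with [t c] realizing [pi0 y]. Hence [a^-1 b]
    represents [fhat y], while [a] and [b] represent [fhat x] and [fhat (x * y)]. *)
Lemma fhatM (x y : EL) : fhat (x * y) = fhat x * fhat y.
Proof.
have [a [b [ax bxy ab]]] := circ_realize c C_small (circ_mul x (erefl y : [set y] y)).
rewrite (fhatE ax) (fhatE bxy).
suff /fhatE -> : tp_over ((a^-1 * b)%g \o c) c = sval (pi0 y).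
  by rewrite -cosetLM mulVKg.
have [d [_ yd]] := type_space_sat (pi0 y); rewrite yd.
apply: tp_complete => phi; rewrite -(sat_aut a).
have -> : a \o tuple_cat ((a^-1 * b)%g \o c) c = tuple_cat (b \o c) (a \o c).
  by apply/funext => -[i|//] /=; rewrite aut_invK.
move=> /ab[_ [t [-> ty tphi]]]; rewrite yd in ty.
by rewrite -[sat _ _]/(tp_over d c phi) -ty.
Qed.

End Ellis.

(** * The tau-topology *)

Section TauTopology.
Context (L : language) (T : theory L) (C : monster T) (C' : bigger_monster C).
Context (D : ellis_datum (EL C')).
Local Notation uM := (ellis_group D).
Implicit Types (x y : uM) (A U W : set uM).

Lemma cl_tau_idem A : cl_tau (cl_tau A) `<=` cl_tau A.
Proof.
move=> p /(@circS _ _ _ _ _ _ (circ (idem D) [set sval q | q in A])) H.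
have /circ_circ : circ (idem D) (circ (idem D) [set sval q | q in A]) (sval p).
  by apply: H => _ [q qA <-].
by rewrite idem_idem.
Qed.

Lemma cl_tau_mulr A p y : cl_tau A p -> cl_tau [set x * y | x in A] (p * y).
Proof.
move=> /(circ_mulr (sval y)); apply: circS => _ [_ [x Ax <-] <-].
by exists (x * y) => //; exists x.
Qed.

(** [y p] lies in [circ (y u) A = circ y A]. Each [x] in [A] is [y^-1 (y x)], so [A] is contained in
    [circ y^-1 (y A)], and [y p] lies in [circ (y y^-1) (y A)], where [y y^-1 = u]. *)
Lemma cl_tau_mull A p y : cl_tau A p -> cl_tau [set y * x | x in A] (y * p).
Proof.
pose A' : set (EL C') := [set sval q | q in A].
pose yA : set (EL C') := [set sval q | q in [set y * x | x in A]].
move=> Ap; have : circ (sval y) (circ (idem D) A') (sval y * sval p) by exact: circ_mul.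
move=> /circ_circ; rewrite (ideal_idr (ellis_ideal y)).
move=> /(@circS _ _ _ _ _ _ (circ (sval y^-1) yA)) H.
have /circ_circ : circ (sval y) (circ (sval y^-1) yA) (sval y * sval p).
  apply: H => _ [x Ax <-].
  have -> : sval x = sval y^-1 * sval (y * x).
    by rewrite -[RHS]/(sval (y^-1 * (y * x))) mulKg.
  apply: circ_mul.
  by exists (y * x) => //; exists x.
by rewrite -[sval y * sval y^-1]/(sval (y * y^-1)) mulgV.
Qed.

Lemma tau_mull_open U y : tau_open U -> tau_open [set x | U (y * x)].
Proof.
move=> oU; apply/tau_openP => x /(cl_tau_mull y) Hx Uyx.
suff : cl_tau (~` U) (y * x) by rewrite oU.
by apply: cl_tauS Hx => _ [z nUz <-].
Qed.

Lemma tau_mulr_open U y : tau_open U -> tau_open [set x | U (x * y)].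
Proof.
move=> oU; apply/tau_openP => x /(cl_tau_mulr y) Hx Uyx.
suff : cl_tau (~` U) (x * y) by rewrite oU.
by apply: cl_tauS Hx => _ [z nUz <-].
Qed.

Lemma cl_tau_open A : tau_open (~` cl_tau A).
Proof. by apply/tau_openP; rewrite setCK; exact: cl_tau_idem. Qed.

(** An open [W] disjoint from [U] misses [cl_tau U]. Conversely the complement of [cl_tau V] is open
    by idempotence, and separates its points from 1. *)
Lemma H_tauP x : H_tau D x <-> forall U W, tau_open U -> U 1 ->
  tau_open W -> W x -> U `&` W !=set0.
Proof.
split=> [Hx U W oU U1 oW Wx|Hx V].
  apply: contrapT => UW0.
  have := Hx U (open_nbhs_nbhs (conj (oU : open U) U1)).
  have UW : U `<=` ~` W by move=> y Uy Wy; apply: UW0; exists y.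
  by move=> /(cl_tauS UW); rewrite oW; apply.
rewrite nbhsE => -[U [oU U1] UV]; apply: contrapT => nVx.
have [y [Uy]] := Hx _ _ oU U1 (cl_tau_open V) nVx.
by apply; apply: sub_cl_tau; exact: UV.
Qed.

(* Only separate continuity is used: if [U] and [W] are open neighbourhoods of
   [1] and [x y], choose [z] in both [U] and [W y^-1], and then [t] in both
   [z^-1 U] and [z^-1 W]; the product [z t] lies in [U] and [W]. *)
Lemma H_tau_subgroup : subgroup (H_tau D).
Proof.
split; first by apply/H_tauP => U W oU U1 oW W1; exists 1.
- move=> x y /H_tauP Hx /H_tauP Hy; apply/H_tauP => U W oU U1 oW Wxy.
  have [z [Uz Wzy]] := Hx _ _ oU U1 (tau_mulr_open y oW) Wxy.
  have [||t [Uzt Wzt]] :=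
    Hy _ _ (tau_mull_open z oU) _ (tau_mull_open z oW).
  + by rewrite /= mulg1.
  + exact: Wzy.
  + by exists (z * t).
- move=> x /H_tauP Hx; apply/H_tauP => U W oU U1 oW WVx.
  (* Right translation by [x] carries [W], a neighbourhood of [x^-1], to one of 1, and [U] to one of
     [x]. *)
  have [||t [Wt Ut]] := Hx _ _ (tau_mulr_open x^-1 oW) _
    (tau_mulr_open x^-1 oU).
  + by rewrite /= mul1g.
  + by rewrite /= mulgV.
  + by exists (t * x^-1).
Qed.

Lemma H_tau_normal x y : H_tau D y -> H_tau D (x * y * x^-1).
Proof.
move=> /H_tauP Hy; apply/H_tauP => U W oU U1 oW Wxyx.
have [||t [Ut Wt]] := Hy _ _ (tau_mull_open x (tau_mulr_open x^-1 oU))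
  _ (tau_mull_open x (tau_mulr_open x^-1 oW)).
- by rewrite /= mulg1 mulgV.
- exact: Wxyx.
- by exists (x * t * x^-1).
Qed.

End TauTopology.

(** * The epimorphism onto GalL *)

Section EllisToGalL.
Context (L : language) (T : theory L) (C : monster T) (C' : bigger_monster C).
Local Notation c := (Defs.incl C').
Local Notation Sc := (Sc C').
Local Notation cL := (coset (AutfL C')).

Lemma incl_sat V (v : V -> C) phi : sat (c \o v) phi <-> sat v phi.
Proof. exact: incl_elementary. Qed.

(** Only a finite tuple [d] of [C] matters. As [c] is elementary, the type of [(s c d, c d)] is
    finitely satisfiable in [C], hence realized there. Homogeneity moves the second half onto [d],
    then yields [g2] taking [d] to the first half. *)
Lemma dense_orbit (s : aut C') phi : tp_over (s \o c) c phi ->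
  exists g : aut C, sat (tuple_cat g id) phi.
Proof.
have [I [e [phi' phiE]]] := formula_fin_support phi.
(* [d] lists the elements on either side and [h] records the side, so that both halves share the
   index set [I]. *)
pose d (i : I) : C := match e i with inl x => x | inr x => x end.
pose h (i : I) : I + I := match e i with inl _ => inl i | inr _ => inr i end.
have hE (M : structure L) (a b : C -> M) :
    tuple_cat a b \o e = tuple_cat (a \o d) (b \o d) \o h.
  by apply/funext => i; rewrite /= /h; case ei: (e i) => /=; rewrite /d ei.
rewrite /tp_over /tp /= phiE hE -sat_subst_var => sphi.
have Ismall := smaller_fin C I.
pose p := tp_over (s \o c \o d) (c \o d).
have [|||v pv] := @saturated_realize _ _ C _ p
  (smaller_sum2 (@degree_strong_limit _ _ C) Ismall Ismall).
- by exists (Neg Bot).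
- by rewrite /p /tp_over /tp /=; tauto.
- move=> psi ppsi; have [ex exE] := ex_formula set0 psi.
  have /incl_sat/exE[v [_ vpsi]] : sat (c \o tuple_cat d d) ex.
    by apply/exE; exists (tuple_cat (s \o c \o d) (c \o d)).
  by exists v.
have pE : tp v = p by apply/esym/tp_complete.
have vd : tp (v \o inr) = tp d.
  rewrite tp_subst_var pE /p /tp_over -tp_subst_var.
  by apply/seteqP; split=> psi; rewrite /tp /= incl_sat.
have [g1 g1E] := monster_homogeneous Ismall vd.
have dv : tp d = tp (g1 \o v \o inl).
  rewrite -compA tp_aut tp_subst_var pE /p /tp_over -tp_subst_var.
  rewrite -[tuple_cat _ _ \o inl]/(s \o (c \o d)) tp_aut.
  by apply/seteqP; split=> psi; rewrite /tp /= incl_sat.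
have [g2 g2E] := monster_homogeneous Ismall dv.
exists g2; apply/phiE; rewrite hE -sat_subst_var.
have -> : tuple_cat (g2 \o d) (id \o d) = g1 \o v.
  apply/funext => -[i|i]; first by have /(congr1 (fun f => f i)) := g2E.
  by have /(congr1 (fun f => f i)) := g1E.
by rewrite sat_aut; exact: pv.
Qed.

(** Ultralimits of types are realized in [C'], so the automorphisms converge pointwise along [F], to
    a map in the closure defining [EL]. *)
Lemma EL_ultra_limit (F : set_system (aut C)) : UltraFilter F ->
  exists x : EL C', forall (q : Sc) phi,
    sval (sval x q) phi <-> F [set g | sval (act g q) phi].
Proof.
move=> FU; have [s sE] := choice (aut_extends C').
have lim (q : Sc) : exists r : Sc, forall phi,
    sval r phi <-> F [set g | sval (act g q) phi].
  have [a [ac qa]] := type_space_sat q.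
  have [Y YE] := ultra_realize (fun g => s g \o a) c (C_small C') (C_small C').
  have Yc : tp Y = tp c.
    rewrite -ac; apply/esym/tp_complete => phi aphi.
    have /YE : F [set g | tp_over (s g \o a) c (subst_var inl phi)].
      apply: filterS filterT => g _ /=; rewrite /tp_over /tp /= sat_subst_var.
      by rewrite -(sat_aut (s g)) in aphi.
    by rewrite /tp_over /tp /= sat_subst_var.
  have Hr : exists b : C -> C', tp b = tp c /\ tp_over Y c = tp_over b c by exists Y.
  exists (exist (fun p => exists b : C -> C', tp b = tp c /\ p = tp_over b c) _ Hr).
  move=> phi /=; rewrite YE.
  suff -> : [set g | tp_over (s g \o a) c phi] = [set g | act_set g (sval q) phi] by [].
  by apply/seteqP; split=> g /=; rewrite qa (act_set_tp _ (sE g)).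
have [x xE] := choice lim.
have Fx : (fun g => act g : {ptws Sc -> Sc}) @ F --> (x : {ptws Sc -> Sc}).
  by apply/cvg_ptws => q; apply: cvg_Sc => phi /xE.
have xEL : closure (range (act (C' := C')) : set {ptws Sc -> Sc}) x.
  move=> U /Fx UF; have [g Ug] := filter_ex (UF : F [set g | U (act g)]).
  by exists (act g); split=> //; exists g.
by exists (exist _ _ xEL).
Qed.

(** By density, some ultrafilter of automorphisms of [C] moves [tp_c] towards the type of [s c] over
    [c]; its limit in [EL] is the preimage. *)
Lemma fhat_surj (X : quot (AutfL C')) : exists x : EL C', fhat x = X.
Proof.
have [s <-] := cosetL_surj X.
have tpcE (g : aut C) phi : sval (act g (tp_c C')) phi <-> sat (tuple_cat g id) phi.
  have [t tg] := aut_extends C' g.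
  rewrite -[sval _]/(act_set g (tp_over c c)) (act_set_tp _ tg) tg -incl_sat.
  suff -> : c \o tuple_cat g id = tuple_cat (c \o g) c by [].
  by apply/funext => -[].
have [|phi psi|g phi psi|phi|F [FU Fs]] := @ultra_of_types L _ _
  (tp_over (s \o c) c) (fun g : aut C => sat (tuple_cat g id)).
- by exists (Neg Bot).
- by rewrite /tp_over /tp /=; tauto.
- by move=> H; split; apply: contrapT; move: H => /=; tauto.
- exact: dense_orbit.
have [x xE] := EL_ultra_limit FU.
exists x; apply: fhatE; have [a [_ xa]] := type_space_sat (pi0 x).
rewrite xa; apply: tp_complete => phi /Fs sphi.
have /xE : F [set g | sval (act g (tp_c C')) phi].
  by apply: filterS sphi => g /tpcE.
by rewrite -/(pi0 x) xa.
Qed.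

Context (D : ellis_datum (EL C')) (M : small_model C').
Local Notation uM := (ellis_group D).
Local Notation f := (ellis_to_GalL D M).

Lemma fhat_idem : fhat (idem D) = 1 :> GalL M.
Proof.
have H : (fhat (idem D) : GalL M) = (fhat (idem D) : GalL M) * fhat (idem D).
  by rewrite -[RHS]fhatM idem_idem.
by apply: (mulgI (fhat (idem D) : GalL M)); rewrite -H mulg1.
Qed.

Lemma ellis_to_GalLM : {morph f : x y / x * y}.
Proof. by move=> x y; exact: fhatM. Qed.

Lemma ellis_to_GalL_surj (X : GalL M) : exists x, f x = X.
Proof.
have [x xX] := fhat_surj X.
(* [u x u] lies in [uM] and has the image of [x], as [u] goes to 1. *)
have ux : exists2 y, ideal D y & idem D * x * idem D = idem D * y.
  exists (x * idem D); last by rewrite mulgA.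
  exact/ideal_mull/idem_ideal.
pose uxu : uM := exist (fun z => exists2 y, ideal D y & z = idem D * y) _ ux.
exists uxu; transitivity ((fhat (idem D) : GalL M) * fhat x * fhat (idem D)).
  by rewrite -[LHS]/(fhat (idem D * x * idem D)) !fhatM.
by rewrite fhat_idem mul1g mulg1.
Qed.

Lemma ellis_to_GalL_continuous : continuous f.
Proof.
apply/continuousP => U oU; apply/tau_openP => x ux Ux.
have [a [b [au bx ab]]] := circ_realize (small_incl M) (small_small M) ux.
have fx : f x = (cL (a^-1 * b)%g : GalL M).
  have a1 : (cL a : GalL M) = 1 by rewrite -fhat_idem; exact/esym/fhatE.
  transitivity ((cL a : GalL M) * (cL (a^-1 * b)%g : GalL M)).
    by rewrite -[RHS]cosetLM mulVKg; exact: fhatE.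
  by rewrite a1; exact: mul1g.
move: Ux; rewrite /= fx => Uab.
have /GalL_openP/(_ _ Uab)[phi [abphi phiU]] := oU.
(* As [(b m, a m)] satisfies [phi], so does [(t m, m)] for some [t] representing [f q] outside [U],
   although [phi] forces the class of [t] into [U]. *)
have [|eta [t [[q nUq <-] tq tphi]]] := ab phi.
  move: abphi; rewrite /tp_over /tp /= -(sat_aut a).
  suff -> : a \o tuple_cat ((a^-1 * b)%g \o small_incl M) (small_incl M) =
    tuple_cat (b \o small_incl M) (a \o small_incl M) by [].
  by apply/funext => -[i|//] /=; rewrite aut_invK.
by apply: nUq; rewrite /= /ellis_to_GalL (fhatE tq); exact: phiU.
Qed.

End EllisToGalL.

(** * The kernel of f *)

Section Kernel.
Context (L : language) (T : theory L) (C : monster T) (C' : bigger_monster C).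
Local Notation c := (Defs.incl C').
Local Notation cL := (coset (AutfL C')).

(** A copy [e] of [c] enumerates a small model. Letting it vary makes the relation invariant under
    all automorphisms. *)
Definition same_type_over_copy (a b : C -> C') : Prop := exists e : C -> C',
  tp e = tp c /\ tp (tuple_cat a e) = tp (tuple_cat b e).

(** Some [r] fixing [e] takes [s c] to [t c]; then [s^-1 t] is a conjugate of [r] times
    [s^-1 r^-1 t], which fixes [c]. *)
Lemma same_type_over_copy_coset (s t : aut C') :
  same_type_over_copy (s \o c) (t \o c) -> cL s = cL t.
Proof.
case=> e [ec aebe].
have [g gE] := monster_homogeneous (C_small C') (esym ec).
have [r rE] := monster_homogeneous (sum_small (C_small C') (C_small C')) aebe.
have rst : r \o (s \o c) = t \o c.
  by apply/funext => i; have /(congr1 (fun h => h (inl i))) := rE.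
have re : r \o e = e.
  by apply/funext => i; have /(congr1 (fun h => h (inr i))) := rE.
have gel : elementary (g \o c).
  by move=> V v phi; rewrite -compA sat_aut; exact: incl_elementary.
have rL : AutfL C' r.
  by apply: AutfL_fix; exists (SmallModel gel (C_small C')); rewrite /= gE.
have [_ AM _] := AutfL_subgroup C'.
apply/cosetLP; have -> : s^-1 * t = (s^-1 * r * s^-1^-1) * (s^-1 * r^-1 * t).
  by rewrite invgK !mulgA !mulgK.
apply: AM; first exact: AutfL_normal.
apply: AutfL_fix; exists (incl_small C'); apply/funext => x /=.
have /(congr1 (fun h => h x)) /= <- := rst.
by rewrite !aut_funK.
Qed.

(** An ultralimit of triples [(a', b', e)] keeps both conditions on [e]; its first two parts have
    the type of [(a, b)], and homogeneity moves them there. *)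
Lemma same_type_over_copy_closed (a b : C -> C') :
  (forall phi, sat (tuple_cat a b) phi -> exists a' b',
     same_type_over_copy a' b' /\ sat (tuple_cat a' b') phi) ->
  same_type_over_copy a b.
Proof.
move=> H; pose K := {x : (C -> C') * (C -> C') * (C -> C') |
  tp x.2 = tp c /\ tp (tuple_cat x.1.1 x.2) = tp (tuple_cat x.1.2 x.2)}.
pose ab (k : K) := tuple_cat (sval k).1.1 (sval k).1.2.
have [|phi psi|k phi psi|phi /H[a' [b' [[e ee'] abphi]]]|F [FU FR]] :=
  @ultra_of_types L _ _ (tp (tuple_cat a b)) (fun k : K => sat (ab k)).
- by exists (Neg Bot).
- by rewrite /tp /=; tauto.
- by move=> {}H; split; apply: contrapT; move: H => /=; tauto.
- by exists (exist _ (a', b', e) ee').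
have Cs := C_small C'; have CCs := sum_small Cs Cs.
pose X (k : K) := tuple_cat (ab k) (sval k).2.
have [Y YE] := ultra_realize X c (sum_small CCs Cs) Cs.
have {}YE V (k : V -> (C + C) + C) phi :
    sat (Y \o k) phi <-> F [set i | sat (X i \o k) phi].
  rewrite -[Y]/(tuple_cat Y c \o inl) -compA -sat_subst_var [X in X <-> _]YE.
  suff -> : [set i | tp_over (X i) c (subst_var (inl \o k) phi)] =
    [set i | sat (X i \o k) phi] by [].
  by apply/seteqP; split=> i; rewrite /tp_over /tp /= sat_subst_var.
have tY : tp (Y \o inl) = tp (tuple_cat a b).
  by apply/esym/tp_complete => phi /FR Fphi; apply/YE; exact: Fphi.
have [s sY] := monster_homogeneous CCs tY.
pose ka (x : C + C) : (C + C) + C := match x with inl i => inl (inl i) | inr i => inr i end.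
pose kb (x : C + C) : (C + C) + C := match x with inl i => inl (inr i) | inr i => inr i end.
exists (s \o (Y \o inr)); split.
  rewrite tp_aut; apply/esym/tp_complete => phi cphi; apply/YE.
  apply: filterS filterT => k _ /=; have [ec _] := svalP k.
  by rewrite -[sat _ _]/(tp (sval k).2 phi) ec.
have sE (d : C -> C') l : tuple_cat d (s \o (Y \o inr)) = s \o (Y \o l) ->
    tp (tuple_cat d (s \o (Y \o inr))) = tp (Y \o l).
  by move=> ->; exact: tp_aut.
have sYi i : s (Y (inl i)) = tuple_cat a b i.
  by have /(congr1 (fun h => h i)) := sY.
rewrite (sE a ka); last by apply/funext => -[i|//]; rewrite /= sYi.
rewrite (sE b kb); last by apply/funext => -[i|//]; rewrite /= sYi.
apply: tp_complete => phi /YE Fphi; apply/YE.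
apply: filterS Fphi => k /=; have [_ kE] := svalP k.
have -> : X k \o ka = tuple_cat (sval k).1.1 (sval k).2 by apply/funext => -[].
have -> : X k \o kb = tuple_cat (sval k).1.2 (sval k).2 by apply/funext => -[].
by rewrite -[sat _ _]/(tp _ phi) kE.
Qed.

Context (D : ellis_datum (EL C')).
Local Notation u := (idem D).

(** By [same_type_over_copy_closed], the pairs satisfying all these formulas are exactly the related
    ones. *)
Definition theta : set (formula L (C + C)) := [set phi | forall a b,
  same_type_over_copy a b -> sat (tuple_cat a b) phi].

(* [cl_tau A], with [A] the set where [phi] fails, misses [1], because pairs of
   realizations of [pi0 u] have the same type over [c].  Its complement is thus
   a neighbourhood of [1], and [phi] passes to the closure of the complement. *)
Lemma H_tau_theta (p : ellis_group D) phi : H_tau D p -> theta phi ->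
  exists a b : aut C', [/\ tp_over (a \o c) c = sval (pi0 u),
    tp_over (b \o c) c = sval (pi0 (sval p)) & sat (tuple_cat (b \o c) (a \o c)) phi].
Proof.
move=> Hp tphi; pose A := [set q : ellis_group D | ~ sval (pi0 (sval q)) phi].
pose V := ~` cl_tau A.
have oV : open V by exact: cl_tau_open.
have V1 : V 1.
  move=> /(circ_realize c (C_small C'))[a [b [au bu ab]]].
  have [|eta [t [[q nq <-] tq tphi']]] := ab phi.
    by apply: tphi; exists c; split=> //; exact: etrans bu (esym au).
  by apply: nq; rewrite -tq.
have /(circ_realize c (C_small C'))[a [b [au bp ab]]] := Hp V (open_nbhs_nbhs (conj oV V1)).
exists a, b; split=> //; apply: contrapT => nphi.
have [eta [t [[q Vq <-] tq ntphi]]] := ab (Neg phi) nphi.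
by apply: Vq; apply: sub_cl_tau => qphi; apply: ntphi; rewrite -tq in qphi.
Qed.

Lemma H_tau_ker (p : ellis_group D) : H_tau D p -> fhat (sval p) = fhat u.
Proof.
move=> Hp.
have tAnd phi psi : theta phi -> theta psi -> theta (And phi psi).
  move=> tphi tpsi a b ab; have := tphi _ _ ab; have := tpsi _ _ ab => /=; tauto.
pose K := {ab : aut C' * aut C' | tp_over (ab.1 \o c) c = sval (pi0 u) /\
  tp_over (ab.2 \o c) c = sval (pi0 (sval p))}.
pose X (k : K) := tuple_cat ((sval k).2 \o c) ((sval k).1 \o c).
have [||k phi psi|phi tphi|F [FU Ft]] :=
  @ultra_of_types L _ _ theta (fun k => sat (X k)).
- by exists (Neg Bot) => a b _ /=.
- exact: tAnd.
- by move=> H; split; apply: contrapT; move: H => /=; tauto.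
- have [a [b [au bp ab]]] := H_tau_theta Hp tphi.
  by exists (exist _ (a, b) (conj au bp)).
have Cs := C_small C'; have CCs := sum_small Cs Cs.
have [Y YE] := ultra_realize X c CCs Cs.
(* The type over [c] of each half is constant along [K], so the limit keeps it. *)
have lim (q : Sc C') (z : K -> aut C') (f : C -> C + C) :
    (forall k, tp_over (z k \o c) c = sval q) -> (forall k, X k \o f = z k \o c) ->
    exists r : aut C', r \o c = Y \o f /\ tp_over (r \o c) c = sval q.
  move=> zq zX.
  have YfE : tp_over (Y \o f) c = sval q.
    have [d [_ qd]] := type_space_sat q; rewrite qd; apply/esym/tp_complete => phi.
    move=> dphi; pose l (x : C + C) : (C + C) + C :=
      match x with inl i => inl (f i) | inr i => inr i end.
    have /YE : F [set k | tp_over (X k) c (subst_var l phi)].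
      apply: filterS filterT => k _ /=; rewrite /tp_over /tp /= sat_subst_var.
      have -> : tuple_cat (X k) c \o l = tuple_cat (X k \o f) c by apply/funext => -[].
      by rewrite zX -[sat _ _]/(tp_over (z k \o c) c phi) zq qd.
    rewrite /tp_over /tp /= sat_subst_var.
    suff -> : tuple_cat Y c \o l = tuple_cat (Y \o f) c by [].
    by apply/funext => -[].
  have cYf : tp c = tp (Y \o f).
    have [d [dc qd]] := type_space_sat q.
    rewrite -[Y \o f]/(tuple_cat (Y \o f) c \o inl) tp_subst_var.
    by rewrite -[tp (tuple_cat _ _)]/(tp_over _ _) YfE qd /tp_over -tp_subst_var.
  by have [r rY] := monster_homogeneous Cs cYf; exists r; rewrite rY.
have [a [aY au]] := lim _ _ inr (fun k => (svalP k).1) (fun k => erefl).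
have [b [bY bp]] := lim _ _ inl (fun k => (svalP k).2) (fun k => erefl).
rewrite (fhatE au) (fhatE bp); apply: same_type_over_copy_coset.
apply: same_type_over_copy_closed => phi abphi; apply: contrapT => nphi.
(* If no related pair satisfied [phi], its negation would be in [theta] and hold of the limit
   pair. *)
have tneg : theta (Neg phi) by move=> a' b' ab' abphi'; apply: nphi; exists a', b'.
have /YE : F [set k | tp_over (X k) c (subst_var inl (Neg phi))].
  by apply: filterS (Ft _ tneg) => k /=; rewrite /tp_over /tp /= sat_subst_var.
rewrite /tp_over /tp /= sat_subst_var; apply.
suff -> : tuple_cat Y c \o inl = tuple_cat (b \o c) (a \o c) by [].
by rewrite aY bY; apply/funext => -[].
Qed.

End Kernel.

(** * Factoring [f] through the quotient by [H] *)

Theorem theorem3p7 (L : language) (T : theory L) (hT : complete T)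
    (C : monster T) (C' : bigger_monster C)
    (D : ellis_datum (EL C')) (M : small_model C') :
  let f : ellis_group D -> GalL M := ellis_to_GalL D M in
  [/\ continuous f,
      H_tau D `<=` [set p | f p = 1] &
      exists fbar : quot (H_tau D) -> GalL M,
        [/\ forall p, fbar (coset (H_tau D) p) = f p,
            continuous_epi fbar,
            continuous_epi (coset (H_tau D) : ellis_group D -> quot (H_tau D)) &
            continuous_epi (coset (Gal0 M) : GalL M -> GalKP M)]].
Proof.
move=> f.
have fc : continuous f := @ellis_to_GalL_continuous _ _ _ _ D M.
have fM : {morph f : x y / x * y} := @ellis_to_GalLM _ _ _ _ D M.
have Hker : H_tau D `<=` [set p | f p = 1].
  by move=> p /H_tau_ker fp; rewrite /= -(fhat_idem D M).
have cH : {morph coset (H_tau D) : x y / x * y} :=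
  cosetM (@H_tau_subgroup _ _ _ _ D) (@H_tau_normal _ _ _ _ D).
pose fbar (X : quot (H_tau D)) : GalL M := f (repr X).
(* The chosen representative differs from [p] by an element of [H], which [f] sends to 1. *)
have fbarE p : fbar (coset (H_tau D) p) = f p.
  have /(coset_eqP (@H_tau_subgroup _ _ _ _ D))/Hker/= fr :=
    esym (coset_repr (coset (H_tau D) p)).
  by rewrite /fbar -[repr _](mulVKg p) fM fr mulg1.
split=> //; exists fbar; split=> //.
- split=> [|X Y|X].
  + apply/continuousP => U oU.
    suff : open (coset (H_tau D) @^-1` (fbar @^-1` U)) by [].
    suff -> : coset (H_tau D) @^-1` (fbar @^-1` U) = f @^-1` U.
      by move/continuousP : fc; apply.
    by apply/seteqP; split=> p; rewrite /= fbarE.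
  + rewrite -(coset_repr X) -(coset_repr Y) -[fbar (_ * _)]/(fbar (coset _ _ * coset _ _)).
    by rewrite -cH !fbarE fM.
  + have [p fp] := ellis_to_GalL_surj D X.
    by exists (coset (H_tau D) p); rewrite fbarE.
- exact: coset_epi cH.
- exact: coset_epi (cosetM (Gal0_subgroup M) (@Gal0_normal _ _ _ M)).
Qed.
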